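(* If a nest $\mathcal{N}$ has ordinal type at least $\omega^2$, then $$\mathrm{ltsr}(\mathcal{T}(\mathcal{N}))=\mathrm{rtsr}(\mathcal{T}(\mathcal{N}))=\infty.$$
   Context: A nest $\mathcal{N}$ is a complete chain (with respect to inclusion) of closed subspaces of a Hilbert space $\mathcal{H}$ containing $\{0\}$ and $\mathcal{H}$. The nest algebra $\mathcal{T}(\mathcal{N})$ is the algebra of all $T\in\mathcal{B}(\mathcal{H})$ with $TN\subset N$ for every $N\in\mathcal{N}$. An interval is a subspace $N\ominus M$ with $M<N$ in $\mathcal{N}$, and an atom is a minimal interval. When $\mathcal{N}$ is well ordered (by inclusion), it has ordinal (order) type $\alpha$ if its atoms, in their natural order, are of order type $\alpha$. For a unital Banach algebra $\mathfrak{A}$, $\mathrm{rtsr}(\mathfrak{A})$ (right topological stable rank) is the least positive integer $n$ such that the set of $(a_1,\dots,a_n)\in\mathfrak{A}^n$ for which there is $(b_1,\dots,b_n)\in\mathfrak{A}^n$ with $\sum_{i=1}^n a_ib_i=1$ is dense in $\mathfrak{A}^n$; it is $\infty$ if no such $n$ exists. The left topological stable rank $\mathrm{ltsr}(\mathfrak{A})$ is defined analogously with $\sum_{i=1}^n b_ia_i=1$. *)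

(* Defs.v *)
From HB Require Import structures.
From mathcomp Require Import all_boot all_order all_algebra.
From mathcomp Require Import complex wochoice.
From mathcomp Require Import all_classical all_reals all_analysis.

Set Implicit Arguments.
Unset Strict Implicit.
Unset Printing Implicit Defensive.

Import Order.TTheory GRing.Theory Num.Theory.
Import numFieldNormedType.Exports.

Local Open Scope classical_set_scope.
Local Open Scope ring_scope.
Local Open Scope complex_scope.

(* Hilbert spaces are complex, of arbitrary (possibly zero, possibly
   uncountable) Hilbert dimension.  The norm of a normed module over R[i] takes
   its values in R[i].  [inner] is linear in its first argument and
   conjugate-linear in the second. *)
HB.mixin Record CompleteNormedModule_isHilbert (R : realType) H
    & CompleteNormedModule R[i] H := {
  inner : {dot H for (@Num.conj R[i])} ;
  normr_inner : forall x : H, `|x| ^+ 2 = inner x x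
}.

#[short(type="hilbertType")]
HB.structure Definition Hilbert (R : realType) :=
  {H of CompleteNormedModule R[i] H & CompleteNormedModule_isHilbert R H}.

(* The unit and product are fields of the mixin because the existing hierarchy
   does not allow a structure inheriting both from (possibly zero) rings and
   from normed modules.  |bone| = 1 is not required, so that B({0}) is allowed. *)
HB.mixin Record isBanachAlgebra (K : numFieldType) A
    & CompleteNormedModule K A := {
  bone : A ;
  bmul : A -> A -> A ;
  bmulA : associative bmul ;
  bmul1 : left_id bone bmul ;
  bmulr1 : right_id bone bmul ;
  bmulDl : left_distributive bmul +%R ;
  bmulDr : right_distributive bmul +%R ;
  bscaleAl : forall (k : K) (a b : A), k *: bmul a b = bmul (k *: a) b ;
  bscaleAr : forall (k : K) (a b : A), k *: bmul a b = bmul a (k *: b) ;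
  ler_normbM : forall a b : A, `|bmul a b| <= `|a| * `|b|
}.

#[short(type="banachAlgType")]
HB.structure Definition BanachAlgebra (K : numFieldType) :=
  {A of CompleteNormedModule K A & isBanachAlgebra K A}.

(* The tuple space A^n is 'rV[A]_n with its entrywise (product) topology.
   The least positive integer n with the density property, or infinity, is an
   infimum in \bar R: the infimum of a nonempty set of naturals is attained,
   and ereal_inf set0 = +oo. *)
Section stable_rank.
Context {R : realType} (A : banachAlgType R[i]).

Definition right_unimodular n : set 'rV[A]_n :=
  [set a | exists b : 'rV[A]_n, \sum_(i < n) bmul (a ord0 i) (b ord0 i) = bone].

Definition left_unimodular n : set 'rV[A]_n :=
  [set a | exists b : 'rV[A]_n, \sum_(i < n) bmul (b ord0 i) (a ord0 i) = bone].

Definition rtsr : \bar R :=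
  ereal_inf [set (n%:R)%:E | n in
    [set n : nat | (0 < n)%N /\ dense (@right_unimodular n)]].

Definition ltsr : \bar R :=
  ereal_inf [set (n%:R)%:E | n in
    [set n : nat | (0 < n)%N /\ dense (@left_unimodular n)]].

End stable_rank.

Lemma normr_Re {R : realType} {V : normedModType R[i]} (x : V) :
  (complex.Re `|x|)%:C = `|x|.
Proof. by rewrite RRe_real// normr_real. Qed.

Section bounded_op_def.
Context {R : realType} {H : hilbertType R}.

Definition is_bounded_op : {pred H -> H} :=
  [pred T : H -> H | `[< linear T /\
    exists M : R, forall x, `|T x| <= M%:C * `|x| >] ].

Lemma is_bounded_opP (T : H -> H) : reflect
  (linear T /\ exists M : R, forall x, `|T x| <= M%:C * `|x|)
  (T \in is_bounded_op).
Proof. exact: asboolP. Qed.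

Lemma is_bounded_op_submod : submod_closed is_bounded_op.
Proof.
split.
  apply/is_bounded_opP; split.
    by move=> a x y; rewrite /= scaler0 addr0.
  by exists 0 => x; rewrite /= normr0 mul0r.
move=> a S T /is_bounded_opP[lS [M SM]] /is_bounded_opP[lT [N TN]].
apply/is_bounded_opP; split.
  move=> b x y.
  change (a *: S (b *: x + y) + T (b *: x + y) =
          b *: (a *: S x + T x) + (a *: S y + T y)).
  by rewrite lS lT !scalerDr !scalerA (mulrC a b) addrACA.
exists (complex.Re `|a| * M + N) => x.
change (`|a *: S x + T x| <= (complex.Re `|a| * M + N)%:C * `|x|).
have -> : (complex.Re `|a| * M + N)%:C = `|a| * M%:C + N%:C :> R[i].
  rewrite -[X in _ = X * _ + _](@RRe_real _ `|a|) ?normr_real//.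
  by rewrite -rmorphM -rmorphD.
rewrite (le_trans (ler_normD _ _))// normrZ mulrDl lerD//.
by rewrite -mulrA ler_wpM2l.
Qed.

End bounded_op_def.

HB.instance Definition _ (R : realType) (H : hilbertType R) :=
  GRing.isSubmodClosed.Build R[i] (H -> H) (@is_bounded_op R H)
    (@is_bounded_op_submod R H).

Record bounded_op {R : realType} (H : hilbertType R) := BoundedOp {
  bop_fun :> H -> H ;
  _ : bop_fun \in is_bounded_op
}.

HB.instance Definition _ (R : realType) (H : hilbertType R) :=
  [isSub for @bop_fun R H].
HB.instance Definition _ (R : realType) (H : hilbertType R) :=
  [Choice of bounded_op H by <:].
HB.instance Definition _ (R : realType) (H : hilbertType R) :=
  [SubChoice_isSubLmodule of bounded_op H by <:].

Section operator_norm.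
Context {R : realType} {H : hilbertType R}.
Implicit Types S T : bounded_op H.

Lemma bop_linear T : linear T.
Proof. by have /is_bounded_opP[] := valP T. Qed.

HB.instance Definition _ T := GRing.isLinear.Build R[i] H H *:%R T
  (bop_linear T).

Lemma bopD S T x : (S + T) x = S x + T x. Proof. by []. Qed.
Lemma bopB S T x : (S - T) x = S x - T x. Proof. by []. Qed.
Lemma bopZ a T x : (a *: T) x = a *: T x. Proof. by []. Qed.

Lemma bopP S T : S =1 T -> S = T.
Proof. by move=> ST; apply: val_inj; apply/funext. Qed.

Definition opnorm T : R :=
  sup [set complex.Re `|T x| | x in [set x : H | `|x| <= 1]].

Lemma opnorm_has_sup T :
  has_sup [set complex.Re `|T x| | x in [set x : H | `|x| <= 1]].
Proof.
split; first by exists (complex.Re `|T 0|), 0; rewrite //= normr0.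
have /is_bounded_opP[_ [M TM]] := valP T.
exists `|M| => _ [x /= x1 <-]; rewrite -lecR normr_Re (le_trans (TM x))//.
rewrite (@le_trans _ _ (`|M|%:C * `|x|))//.
  by rewrite ler_wpM2r// lecR ler_norm.
by rewrite ler_piMr// lecR.
Qed.

Lemma ler_opnorm T x : `|T x| <= (opnorm T)%:C * `|x|.
Proof.
have [->|x0] := eqVneq x 0; first by rewrite raddf0 !normr0 mulr0.
have nx0 : 0 < `|x| by rewrite normr_gt0.
rewrite -ler_pdivrMr// mulrC.
have -> : `|x|^-1 * `|T x| = `|T (`|x|^-1 *: x)|.
  by rewrite linearZ/= normrZ normfV normr_id.
rewrite -normr_Re lecR; apply: sup_upper_bound; first exact: opnorm_has_sup.
exists (`|x|^-1 *: x) => //=.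
by rewrite normrZ normfV normr_id mulVf// gt_eqF.
Qed.

Lemma opnorm_ge0 T : 0 <= opnorm T.
Proof.
apply: sup_upper_bound; first exact: opnorm_has_sup.
by exists 0; rewrite /= ?normr0// raddf0 normr0.
Qed.

Lemma opnorm_le T (M : R[i]) : 0 <= M ->
  (forall x, `|T x| <= M * `|x|) -> (opnorm T)%:C <= M.
Proof.
move=> M0 TM; rewrite -[M]RRe_real ?ger0_real// lecR.
apply: ge_sup; first by have [] := opnorm_has_sup T.
move=> _ [x /= x1 <-]; rewrite -lecR normr_Re RRe_real ?ger0_real//.
by rewrite (le_trans (TM x))// ler_piMr.
Qed.

Lemma opnormD S T :
  (opnorm (S + T))%:C <= (opnorm S)%:C + (opnorm T)%:C :> R[i].
Proof.
apply: opnorm_le => [|x]; first by rewrite addr_ge0// lecR opnorm_ge0.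
by rewrite bopD (le_trans (ler_normD _ _))// mulrDl lerD ?ler_opnorm.
Qed.

Lemma opnormZ_le (a : R[i]) T :
  (opnorm (a *: T))%:C <= `|a| * (opnorm T)%:C :> R[i].
Proof.
apply: opnorm_le => [|x]; first by rewrite mulr_ge0// lecR opnorm_ge0.
by rewrite bopZ normrZ -mulrA ler_wpM2l ?ler_opnorm.
Qed.

Lemma opnorm_eq0 T : (opnorm T)%:C = 0 :> R[i] -> T = 0.
Proof.
move=> T0; apply: bopP => x; apply/eqP; rewrite -normr_le0.
by rewrite (le_trans (ler_opnorm T x))// T0 mul0r.
Qed.

Lemma opnormZ (a : R[i]) T :
  (opnorm (a *: T))%:C = `|a| * (opnorm T)%:C :> R[i].
Proof.
have [->|a0] := eqVneq a 0.
  rewrite scale0r normr0 mul0r; apply/le_anti/andP; split; last by rewrite lecR opnorm_ge0.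
  by apply: opnorm_le => // x; rewrite normr0 mul0r.
apply/eqP; rewrite eq_le opnormZ_le/=.
rewrite -ler_pdivlMl ?normr_gt0// -normfV.
have := opnormZ_le a^-1 (a *: T).
by rewrite scalerA mulVf// scale1r.
Qed.

End operator_norm.

HB.instance Definition _ (R : realType) (H : hilbertType R) :=
  Lmodule_isNormed.Build R[i] (bounded_op H) opnormD opnormZ opnorm_eq0.

Section bounded_op_complete.
Context {R : realType} {H : hilbertType R}.
Implicit Types S T : bounded_op H.

Lemma normr_bop T : `|T| = (opnorm T)%:C. Proof. by []. Qed.

Lemma ler_normr_bop T x : `|T x| <= `|T| * `|x|.
Proof. exact: ler_opnorm. Qed.

Lemma normr_bop_le T (M : R[i]) : 0 <= M ->
  (forall x, `|T x| <= M * `|x|) -> `|T| <= M.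
Proof. exact: opnorm_le. Qed.

Lemma bop_cvg_at (F : set_system (bounded_op H)) (FF : Filter F) T x :
  F --> T -> (fun S : bounded_op H => S x) @ F --> T x.
Proof.
move=> FT; apply/cvgrPdist_lt => e e0.
have ex0 : 0 < e / (`|x| + 1) by rewrite divr_gt0// ltr_wpDl.
near=> S; rewrite -bopB (le_lt_trans (ler_normr_bop _ _))//.
rewrite (@le_lt_trans _ _ (`|T - S| * (`|x| + 1)))//.
  by rewrite ler_wpM2l ?lerDl.
rewrite -ltr_pdivlMr; last by rewrite ltr_wpDl.
by near: S; move/fcvgrPdist_lt : FT; exact.
Unshelve. all: by end_near. Qed.

Lemma bounded_op_complete (F : set_system (bounded_op H)) :
  ProperFilter F -> cauchy F -> cvg F.
Proof.
move=> PF /cauchyP Fc.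
have Fxc x : cvg ((fun T : bounded_op H => T x) @ F).
  apply: cauchy_cvg; apply: cauchy_exP => e e0.
  have ex0 : 0 < e / (`|x| + 1) by rewrite divr_gt0// ltr_wpDl.
  have [T0 FT0] := Fc _ ex0; exists (T0 x).
  change (F [set T : bounded_op H | ball (T0 x) e (T x)]).
  apply: filterS FT0 => T /=; rewrite -!ball_normE => T0T.
  change (`|T0 x - T x| < e).
  rewrite -bopB (le_lt_trans (ler_normr_bop _ _))//.
  rewrite (@le_lt_trans _ _ (`|T0 - T| * (`|x| + 1)))//.
    by rewrite ler_wpM2l// lerDl.
  by rewrite -ltr_pdivlMr ?ltr_wpDl.
pose L x := lim ((fun T : bounded_op H => T x) @ F).
have FL x : (fun T : bounded_op H => T x) @ F --> L x by exact: Fxc.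
have linL : linear L.
  move=> a x y; apply: (cvg_unique _ (FL (a *: x + y))).
    exact: norm_hausdorff.
  have -> : (fun T : bounded_op H => T (a *: x + y)) =
            (fun T : bounded_op H => a *: T x + T y).
    by apply/funext => T; rewrite linearP.
  by apply: cvgD => //; apply: cvgZl_tmp.
have Lest (e : R[i]) : 0 < e -> exists T0 : bounded_op H,
    F (ball T0 e) /\ forall x, `|T0 x - L x| <= e * `|x|.
  move=> e0; have [T0 FT0] := Fc _ e0; exists T0; split=> // x.
  apply/ler_addgt0Pr => d d0; near F => T.
  rewrite -(subrKA (T x)) (le_trans (ler_normD _ _))// lerD//.
    rewrite -bopB (le_trans (ler_normr_bop _ _))// ler_wpM2r// ltW//.
    by near: T; apply: filterS FT0 => T; rewrite -ball_normE.
  by rewrite distrC ltW//; near: T; move/cvgrPdist_lt : (FL x); exact.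
have bL : L \in is_bounded_op.
  apply/is_bounded_opP; split=> //.
  have [T0 [_ T0L]] := Lest 1 ltr01; exists (opnorm T0 + 1) => x.
  rewrite -[L x](subKr (T0 x)) (le_trans (ler_normB _ _))//.
  have -> : (opnorm T0 + 1)%:C = `|T0| + 1 :> R[i] by rewrite rmorphD.
  by rewrite mulrDl lerD// ler_normr_bop.
apply/cvg_ex; exists (BoundedOp bL); apply/fcvgrPdist_lt => e e0.
have e20 : 0 < e / 2 by rewrite divr_gt0.
have [T0 [FT0 T0L]] := Lest _ e20.
apply: filterS FT0 => T; rewrite -ball_normE/= => T0T.
rewrite -(subrKA T0) [e]splitr (le_lt_trans (ler_normD _ _))// ler_ltD//.
by rewrite distrC; apply: normr_bop_le => [|x]; [exact: ltW|exact: T0L].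
Unshelve. all: by end_near. Qed.

End bounded_op_complete.

HB.instance Definition _ (R : realType) (H : hilbertType R) :=
  Uniform_isComplete.Build (bounded_op H) (@bounded_op_complete R H).

Section bounded_op_ring.
Context {R : realType} {H : hilbertType R}.
Implicit Types S T U : bounded_op H.

Lemma bop1_subproof : @idfun H \in is_bounded_op.
Proof.
by apply/is_bounded_opP; split=> //; exists 1 => x; rewrite mul1r.
Qed.

Definition bop1 := BoundedOp bop1_subproof.

Lemma bop_comp_subproof S T : S \o T \in is_bounded_op.
Proof.
apply/is_bounded_opP; split=> [a x y|]; first by rewrite /= !linearP.
exists (opnorm S * opnorm T) => x.
rewrite (le_trans (ler_opnorm _ _))// rmorphM -mulrA.
by rewrite ler_wpM2l ?ler_opnorm// lecR opnorm_ge0.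
Qed.

Definition bop_comp S T := BoundedOp (bop_comp_subproof S T).

Lemma bop_compA : associative bop_comp.
Proof. by move=> S T U; exact: bopP. Qed.

Lemma bop_comp1 : left_id bop1 bop_comp.
Proof. by move=> S; exact: bopP. Qed.

Lemma bop_compr1 : right_id bop1 bop_comp.
Proof. by move=> S; exact: bopP. Qed.

Lemma bop_compDl : left_distributive bop_comp +%R.
Proof. by move=> S T U; exact: bopP. Qed.

Lemma bop_compDr : right_distributive bop_comp +%R.
Proof. by move=> S T U; apply: bopP => x; rewrite /= linearD. Qed.

HB.instance Definition _ := GRing.Zmodule_isPzRing.Build (bounded_op H)
  bop_compA bop_comp1 bop_compr1 bop_compDl bop_compDr.

Lemma bopM S T x : (S * T) x = S (T x). Proof. by []. Qed.

Lemma bop_scaleAl (k : R[i]) S T : k *: (S * T) = (k *: S) * T.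
Proof. exact: bopP. Qed.

Lemma bop_scaleAr (k : R[i]) S T : k *: (S * T) = S * (k *: T).
Proof. by apply: bopP => x; rewrite bopZ !bopM linearZ. Qed.

Lemma ler_normr_bopM S T : `|S * T| <= `|S| * `|T|.
Proof.
apply: normr_bop_le => [|x]; first by rewrite mulr_ge0.
by rewrite bopM (le_trans (ler_normr_bop _ _))// -mulrA ler_wpM2l
  ?ler_normr_bop.
Qed.

HB.instance Definition _ := isBanachAlgebra.Build R[i] (bounded_op H)
  (@mulrA _) (@mul1r _) (@mulr1 _) (@mulrDl _) (@mulrDr _)
  bop_scaleAl bop_scaleAr ler_normr_bopM.

End bounded_op_ring.

Section nest_def.
Context {R : realType} (H : hilbertType R).

Definition closed_subspace (M : set H) := closed M /\ submod_closed (mem M).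

Definition closed_span (A : set H) : set H :=
  \bigcap_(M in [set M | closed_subspace M /\ A `<=` M]) M.

(* Completeness of the chain is relative to the lattice of closed subspaces:
   meets are intersections and joins are closed linear spans. *)
Record nest := Nest {
  nest_set :> set H -> Prop ;
  nest_subspace : forall M, nest_set M -> closed_subspace M ;
  nest_chain : forall M N, nest_set M -> nest_set N -> M `<=` N \/ N `<=` M ;
  nest_bot : nest_set [set 0] ;
  nest_top : nest_set [set: H] ;
  nest_bigcap : forall S : set (set H), S `<=` nest_set ->
    nest_set (\bigcap_(M in S) M) ;
  nest_span : forall S : set (set H), S `<=` nest_set ->
    nest_set (closed_span (\bigcup_(M in S) M))
}.

End nest_def.

Section nest_algebra_def.
Context {R : realType} {H : hilbertType R} (N : nest H).

Definition nest_algebra : {pred bounded_op H} :=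
  [pred T : bounded_op H | `[< forall M, N M -> T @` M `<=` M >] ].

Lemma nest_algebraP (T : bounded_op H) :
  reflect (forall M, N M -> forall x, M x -> M (T x)) (T \in nest_algebra).
Proof.
apply: (iffP (asboolP _)) => TN M NM.
  by move=> x Mx; apply: (TN M NM); exists x.
by move=> _ [x Mx <-]; exact: TN.
Qed.

Lemma nest_lin M a x y : N M -> M x -> M y -> M (a *: x + y).
Proof.
by move=> /nest_subspace[_ [_ ML]] /mem_set Mx /mem_set My; exact/set_mem/ML.
Qed.

Lemma nest0 M : N M -> M 0.
Proof. by move=> /nest_subspace[_ [M0 _]]; exact/set_mem. Qed.

Lemma nest_algebra_submod : submod_closed nest_algebra.
Proof.
split; first by apply/nest_algebraP => M NM x _; exact: nest0.
move=> a S T /nest_algebraP SN /nest_algebraP TN.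
by apply/nest_algebraP => M NM x Mx; apply: nest_lin; [|exact: SN|exact: TN].
Qed.

Lemma nest_algebra_subring : subring_closed nest_algebra.
Proof.
split; first by apply/nest_algebraP.
  move=> S T SN TN; rewrite addrC -scaleN1r.
  by have [_] := nest_algebra_submod; exact.
move=> S T /nest_algebraP SN /nest_algebraP TN.
by apply/nest_algebraP => M NM x Mx; apply: SN => //; exact: TN.
Qed.

End nest_algebra_def.

HB.instance Definition _ (R : realType) (H : hilbertType R) (N : nest H) :=
  GRing.isSubringClosed.Build (bounded_op H) (nest_algebra N)
    (nest_algebra_subring N).
HB.instance Definition _ (R : realType) (H : hilbertType R) (N : nest H) :=
  GRing.isSubmodClosed.Build R[i] (bounded_op H) (nest_algebra N)
    (nest_algebra_submod N).

Record nest_alg {R : realType} {H : hilbertType R} (N : nest H) := NestAlg {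
  nest_op :> bounded_op H ;
  _ : nest_op \in nest_algebra N
}.

HB.instance Definition _ (R : realType) (H : hilbertType R) (N : nest H) :=
  [isSub for @nest_op R H N].
HB.instance Definition _ (R : realType) (H : hilbertType R) (N : nest H) :=
  [Choice of nest_alg N by <:].
HB.instance Definition _ (R : realType) (H : hilbertType R) (N : nest H) :=
  GRing.SubChoice_isSubPzRing.Build (bounded_op H) (nest_algebra N)
    (nest_alg N) (nest_algebra_subring N).
HB.instance Definition _ (R : realType) (H : hilbertType R) (N : nest H) :=
  [SubZmodule_isSubLmodule of nest_alg N by <:].

Section nest_alg_norm.
Context {R : realType} {H : hilbertType R} (N : nest H).
Implicit Types S T : nest_alg N.

Definition nest_alg_norm T : R[i] := `|nest_op T|.

Lemma nest_alg_normD S T :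
  nest_alg_norm (S + T) <= nest_alg_norm S + nest_alg_norm T.
Proof. exact: ler_normD. Qed.

Lemma nest_alg_normZ (k : R[i]) T :
  nest_alg_norm (k *: T) = `|k| * nest_alg_norm T.
Proof. exact: normrZ. Qed.

Lemma nest_alg_norm_eq0 T : nest_alg_norm T = 0 -> T = 0.
Proof. by move=> /normr0_eq0 T0; exact: val_inj. Qed.

HB.instance Definition _ := Lmodule_isNormed.Build R[i] (nest_alg N)
  nest_alg_normD nest_alg_normZ nest_alg_norm_eq0.

Lemma normr_nest_alg T : `|T| = `|nest_op T|. Proof. by []. Qed.

Lemma nest_alg_complete (F : set_system (nest_alg N)) :
  ProperFilter F -> cauchy F -> cvg F.
Proof.
move=> PF /cauchyP Fc.
pose G : set_system (bounded_op H) := (@nest_op R H N) @ F.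
have : cvg G.
  apply: cauchy_cvg; apply: cauchy_exP => e e0.
  have [T0 FT0] := Fc _ e0; exists (nest_op T0).
  change (F [set T : nest_alg N | ball (nest_op T0) e (nest_op T)]).
  by apply: filterS FT0 => T /=; rewrite -!ball_normE.
move=> /cvg_ex[L GL].
have LN : L \in nest_algebra N.
  apply/nest_algebraP => M NM x Mx.
  have [Mcl _] := nest_subspace NM.
  have GM : \forall S \near G, M ((S : bounded_op H) x).
    change (F [set T : nest_alg N | M (nest_op T x)]); apply: filterE => T /=.
    by have /nest_algebraP TN := valP T; exact: TN.
  exact: (@closed_cvg _ _ G _ (fun S : bounded_op H => S x) M Mcl GM _
    (@bop_cvg_at R H G _ L x GL)).
apply/cvg_ex; exists (NestAlg LN); apply/fcvgrPdist_lt => e e0.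
by move/fcvgrPdist_lt : GL => /(_ _ e0).
Qed.

HB.instance Definition _ :=
  Uniform_isComplete.Build (nest_alg N) nest_alg_complete.

Lemma nest_alg_scaleAl (k : R[i]) S T : k *: (S * T) = (k *: S) * T.
Proof. by apply: val_inj; exact: bop_scaleAl. Qed.

Lemma nest_alg_scaleAr (k : R[i]) S T : k *: (S * T) = S * (k *: T).
Proof. by apply: val_inj; exact: bop_scaleAr. Qed.

Lemma ler_normr_nest_algM S T : `|S * T| <= `|S| * `|T|.
Proof. exact: ler_normr_bopM. Qed.

HB.instance Definition _ := isBanachAlgebra.Build R[i] (nest_alg N)
  (@mulrA _) (@mul1r _) (@mulr1 _) (@mulrDl _) (@mulrDr _)
  nest_alg_scaleAl nest_alg_scaleAr ler_normr_nest_algM.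

End nest_alg_norm.

Section atoms.
Context {R : realType} {H : hilbertType R} (N : nest H).

(* For L `<=` M, the subspace $M \ominus L$. *)
Definition orthogonal_difference (M L : set H) : set H :=
  [set x | M x /\ forall y, L y -> inner x y = 0].

Definition interval (E : set H) :=
  exists M L, [/\ N M, N L, L `<` M & E = orthogonal_difference M L].

Definition atom (E : set H) :=
  interval E /\ forall F, interval F -> F `<=` E -> F = E.

(* The natural order of atoms: E precedes F when E lies below some L' in N such
   that F is of the form $M' \ominus L'$. *)
Definition atom_lt (E F : set H) :=
  exists M L M' L', [/\ [/\ N M, N L & L `<` M], [/\ N M', N L' & L' `<` M'],
    E = orthogonal_difference M L, F = orthogonal_difference M' L' &
    M `<=` L'].

Definition atom_le : rel {E : set H | atom E} :=
  fun E F => `[< E = F \/ atom_lt (sval E) (sval F) >].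

Definition nest_well_ordered :=
  forall S : set (set H), S `<=` nest_set N -> S !=set0 ->
    exists2 M, S M & forall L, S L -> M `<=` L.

End atoms.

(* Ordinals are represented by well-ordered types (A, r), r being the non-strict
   order; [ordinal_le r s] says that r is isomorphic to an initial segment of
   s. *)
Definition order_iso (A B : Type) (r : rel A) (s : rel B) :=
  exists2 f : A -> B, bijective f & {mono f : x y / r x y >-> s x y}.

Definition ordinal_le (A B : Type) (r : rel A) (s : rel B) :=
  exists2 f : A -> B, {mono f : x y / r x y >-> s x y} &
    forall x b, s b (f x) -> exists y, f y = b.

(* The lexicographic order on nat * nat (first component most significant) is
   omega copies of omega one after the other. *)
Definition omega2 : rel (nat *l nat)%type := <=%O.

Definition has_ordinal_type {R : realType} {H : hilbertType R} (N : nest H)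
    (A : Type) (r : rel A) :=
  nest_well_ordered N /\ order_iso r (@atom_le R H N).

(* Main.v *)
(* The same idea serves both stable ranks: exhibit a row (column) of operators of
   the nest algebra near which no row (column) is right (left) invertible.  All
   operators used are [x |-> \sum_i <x, e i> g i] for orthonormal families e, g.

   If one of the first omega^2 atoms is infinite-dimensional, its orthonormal
   basis admits n injections into itself with disjoint ranges that do not cover
   it.  They give isometries w_a of the atom with orthogonal ranges and a vector x
   orthogonal to all of them; the rows near (w_a) miss x, and the columns near
   (w_a^* ) are not bounded below, since they nearly kill x after a correction.

   Otherwise the first omega^2 atoms fall into blocks H_0, H_1, ... which are all
   separable and infinite-dimensional.  The partial isometries
   H_(i+1) <-> n copies of H_i lie in the nest algebra because they go down one
   block; the column of coisometries is treated as above.  For the row of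
   isometries from n copies of H_(i+1) to H_i, the diagonal blocks vanish: a
   block upper triangular right inverse b of a nearby row has to be large on the
   last block of b x for x in H_s, and each step towards H_0 increases the norm
   further, so b would be unbounded as s grows. *)
Require Import Defs.
From mathcomp Require Import all_boot all_order all_algebra.
From mathcomp Require Import finmap complex wochoice.
From mathcomp Require Import all_classical all_reals all_analysis.
From mathcomp Require Import ring lra zify.

Set Implicit Arguments.
Unset Strict Implicit.
Unset Printing Implicit Defensive.

Import Order.TTheory GRing.Theory Num.Theory.
Import numFieldNormedType.Exports.

Local Open Scope classical_set_scope.
Local Open Scope ring_scope.
Local Open Scope complex_scope.

(** * Norms and inner products *)

Section real_norm.
Context {R : realType} {V : normedModType R[i]}.
Implicit Types x y : V.

Definition nrm x : R := complex.Re `|x|.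

Lemma nrmE x : `|x| = (nrm x)%:C. Proof. exact/esym/normr_Re. Qed.

Lemma nrm_ge0 x : 0 <= nrm x. Proof. by rewrite -lecR -nrmE; exact: normr_ge0. Qed.

Lemma nrm0 : nrm (0 : V) = 0. Proof. by rewrite /nrm normr0. Qed.

Lemma nrm0_eq0 x : nrm x = 0 -> x = 0.
Proof. by move=> x0; apply/eqP; rewrite -normr_eq0 nrmE x0. Qed.

Lemma nrmD x y : nrm (x + y) <= nrm x + nrm y.
Proof. by rewrite -lecR rmorphD/= -!nrmE ler_normD. Qed.

Lemma nrmN x : nrm (- x) = nrm x. Proof. by rewrite /nrm normrN. Qed.

Lemma nrm_sum (I : Type) (s : seq I) (P : pred I) (F : I -> V) :
  nrm (\sum_(i <- s | P i) F i) <= \sum_(i <- s | P i) nrm (F i).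
Proof.
elim/big_ind2 : _ => //; first by rewrite nrm0.
by move=> x1 x2 y1 y2 *; apply: (le_trans (nrmD _ _)); exact: lerD.
Qed.

End real_norm.

Section inner_product.
Context {R : realType} {H : hilbertType R}.
Implicit Types x y z : H.

Lemma innerDl x y z : inner (x + y) z = inner x z + inner y z.
Proof. exact: linearDl. Qed.

Lemma innerBl x y z : inner (x - y) z = inner x z - inner y z.
Proof. exact: linearBl. Qed.

Lemma innerZl (a : R[i]) x z : inner (a *: x) z = a * inner x z.
Proof. exact: linearZl_LR. Qed.

Lemma innerZr (a : R[i]) x z : inner z (a *: x) = a^*%R * inner z x.
Proof. exact: linearZr_LR. Qed.

Lemma innerDr x y z : inner z (x + y) = inner z x + inner z y.
Proof. exact: linearDr. Qed.

Lemma inner0l x : inner 0 x = 0. Proof. exact: linear0l. Qed.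

Lemma inner0r x : inner x 0 = 0. Proof. exact: linear0r. Qed.

Lemma innerC x y : inner x y = (inner y x)^*%R.
Proof. by rewrite hermC expr0 mul1r. Qed.

Lemma inner_eq0C x y : inner x y = 0 -> inner y x = 0.
Proof. by move=> xy; rewrite innerC xy conjC0. Qed.

Lemma inner_suml (I : Type) (s : seq I) (P : pred I) (F : I -> H) z :
  inner (\sum_(i <- s | P i) F i) z = \sum_(i <- s | P i) inner (F i) z.
Proof. by rewrite linear_sumlz. Qed.

Lemma inner_sumr (I : Type) (s : seq I) (P : pred I) (F : I -> H) z :
  inner z (\sum_(i <- s | P i) F i) = \sum_(i <- s | P i) inner z (F i).
Proof. by rewrite linear_sumr. Qed.

Lemma innerxx x : inner x x = (nrm x ^+ 2)%:C.
Proof. by rewrite -normr_inner nrmE rmorphXn. Qed.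

Lemma innerxx_eq0 x : inner x x = 0 -> x = 0.
Proof. by move/eqP; rewrite dnorm_eq0 => /eqP. Qed.

Lemma pythagoras x y : inner x y = 0 -> nrm (x + y) ^+ 2 = nrm x ^+ 2 + nrm y ^+ 2.
Proof.
move=> xy; have : inner (x + y) (x + y) = inner x x + inner y y by exact: hnormDd.
by rewrite !innerxx -rmorphD => /complexI.
Qed.

Lemma nrm_proj_le x y : inner (x - y) y = 0 -> nrm y <= nrm x.
Proof.
move/pythagoras; rewrite subrK => xy.
by rewrite -(@ler_pXn2r _ 2) ?nnegrE ?nrm_ge0// xy lerDr exprn_ge0 ?nrm_ge0.
Qed.

Lemma cauchy_schwarz x e : nrm e = 1 -> `|inner x e| <= `|x|.
Proof.
move=> e1; have ee : inner e e = 1 by rewrite innerxx e1 expr1n.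
have /nrm_proj_le : inner (x - inner x e *: e) (inner x e *: e) = 0.
  by rewrite innerZr innerBl innerZl ee mulr1 subrr mulr0.
by rewrite -lecR -!nrmE normrZ (nrmE e) e1 mulr1.
Qed.

Lemma cauchy_schwarz_gen x y : `|inner x y| <= `|x| * `|y|.
Proof.
have [->|y0] := eqVneq y 0; first by rewrite inner0r !normr0 mulr0.
have ny0 : 0 < `|y| by rewrite normr_gt0.
have /(cauchy_schwarz x) : nrm (`|y|^-1 *: y) = 1.
  by rewrite /nrm normrZ normfV normr_id mulVf// gt_eqF.
by rewrite innerZr normrM norm_conjC normfV normr_id mulrC ler_pdivrMr.
Qed.

Lemma continuous_innerl y : continuous (fun x => inner x y).
Proof.
move=> x; apply/cvgrPdist_lt => e e0.
have y0 : 0 < `|y| + 1 by rewrite ltr_wpDl.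
near=> z; rewrite -innerBl (le_lt_trans (cauchy_schwarz_gen _ _))//.
apply: (@le_lt_trans _ _ (`|x - z| * (`|y| + 1))).
  by rewrite ler_wpM2l// lerDl.
rewrite -ltr_pdivlMr//; near: z.
by apply: cvgr_dist_lt; [exact: cvg_id|rewrite divr_gt0].
Unshelve. all: by end_near. Qed.

Lemma closed_inner_eq y (c : R[i]) : closed [set x | inner x y = c].
Proof.
apply: (@closed_comp _ _ (fun x => inner x y) [set c]).
  by move=> x _; exact: continuous_innerl.
apply: accessible_closed_set1; apply: hausdorff_accessible.
exact: norm_hausdorff.
Qed.

Lemma closed_nrm_le (c : R) : closed [set x : H | nrm x <= c].
Proof.
move=> x clx /=; apply/ler_addgt0Pr => e e0.
have [z [/= zc]] := clx _ (nbhsx_ballx x e%:C (etrans (ltcR 0 e) e0)).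
rewrite -ball_normE /= nrmE ltcR => xz.
rewrite -(subrK z x) addrC (le_trans (nrmD _ _))//.
by rewrite lerD// ltW.
Qed.

Lemma closed_ortho y : closed_subspace [set x : H | inner x y = 0].
Proof.
split; first exact: closed_inner_eq.
split; first by rewrite mem_set//= inner0l.
move=> a u v /set_mem /= uy /set_mem /= vy; apply: mem_set => /=.
by rewrite innerDl innerZl uy vy mulr0 addr0.
Qed.

End inner_product.

(** * Operators between orthonormal families *)

Section riesz_fischer.
Context {R : realType} {H : hilbertType R} {I : choiceType}.
Implicit Types (e g : I -> H) (c : I -> R[i]) (s t : {fset I}).

Definition orthonormal_family e := forall i j, inner (e i) (e j) = (i == j)%:R.

(** Limits along this filter are unconditional sums over an index type of any cardinality. *)
Definition finite_supersets : set_system {fset I} :=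
  filter_from setT (fun s => [set t | (s `<=` t)%fset]).

Global Instance finite_supersets_filter : ProperFilter finite_supersets.
Proof.
apply: filter_from_proper; last by move=> s _; exists s; rewrite /= fsubset_refl.
apply: filter_fromT_filter; first by exists fset0.
by move=> s t; exists (s `|` t)%fset => u /=; rewrite fsubUset => /andP[].
Qed.

Definition psum c g s : H := \sum_(i <- enum_fset s) c i *: g i.

Lemma inner_psum c g s j : orthonormal_family g ->
  inner (psum c g s) (g j) = if j \in s then c j else 0.
Proof.
move=> gon; rewrite /psum inner_suml.
have [js|js] := boolP (j \in s); last first.
  rewrite big1_seq// => i /= si; rewrite innerZl gon.
  by case: eqVneq si js => [->->//|_ _ _]; rewrite mulr0.
rewrite (bigD1_seq j)//= innerZl gon eqxx mulr1 big1 ?addr0// => i ij.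
by rewrite innerZl gon (negbTE ij) mulr0.
Qed.

Lemma inner_psum_eq0 c g s x : (forall j, j \in s -> inner x (g j) = 0) ->
  inner x (psum c g s) = 0.
Proof.
by move=> x0; rewrite /psum inner_sumr big1_seq// => j /= js; rewrite innerZr x0 ?mulr0.
Qed.

Lemma psum_sub_ortho c g s t : orthonormal_family g -> (s `<=` t)%fset ->
  inner (psum c g t - psum c g s) (psum c g s) = 0.
Proof.
move=> gon st; apply: inner_psum_eq0 => j js.
by rewrite innerBl !inner_psum// js (fsubsetP st _ js) subrr.
Qed.

Lemma nrm_psum c e g s : orthonormal_family e -> orthonormal_family g ->
  nrm (psum c e s) = nrm (psum c g s).
Proof.
move=> eon gon; apply/eqP; rewrite -(@eqrXn2 _ 2) ?nrm_ge0//; apply/eqP.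
apply: complexI; rewrite -[LHS]innerxx -[RHS]innerxx /psum !inner_sumr.
apply: eq_big_seq => j js; rewrite !innerZr.
by rewrite -/(psum c e s) -/(psum c g s) !inner_psum.
Qed.

Lemma bessel x e s : orthonormal_family e ->
  nrm (psum (fun i => inner x (e i)) e s) <= nrm x.
Proof.
move=> eon; apply: nrm_proj_le; apply: inner_psum_eq0 => j js.
by rewrite innerBl inner_psum// js subrr.
Qed.

(** The squared norms of the partial sums grow with the index set and stay bounded, by Bessel for
    [e] and [nrm_psum]. Past a set nearly attaining their supremum, Pythagoras makes every further
    increment small. *)
Lemma psum_cvg x e g : orthonormal_family e -> orthonormal_family g ->
  cvg (psum (fun i => inner x (e i)) g @ finite_supersets).
Proof.
move=> eon gon; set c := fun i => inner x (e i).
apply: cauchy_cvg; apply: cauchy_exP => ec ec0.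
have [d d0 ->] : exists2 d : R, 0 < d & ec = d%:C.
  exists (complex.Re ec); last by rewrite RRe_real// gtr0_real.
  by rewrite -ltcR RRe_real// gtr0_real.
pose S := [set nrm (psum c g s) ^+ 2 | s in [set: {fset I}]].
have Ssup : has_sup S.
  split; first by exists (nrm (psum c g fset0) ^+ 2), fset0.
  exists (nrm x ^+ 2) => _ [s _ <-]; rewrite ler_pXn2r ?nnegrE ?nrm_ge0//.
  by rewrite -(nrm_psum c s eon gon) bessel.
have [_ [s _ <-] sS] := sup_adherent (exprn_gt0 2 d0) Ssup.
exists (psum c g s), s => // t /= st; rewrite -ball_normE /= nrmE ltcR.
rewrite -[X in nrm X]opprB nrmN -(@ltr_pXn2r _ 2) ?nnegrE ?nrm_ge0 ?ltW//.
have := pythagoras (psum_sub_ortho c gon st); rewrite subrK => st2.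
have : nrm (psum c g t) ^+ 2 <= sup S by apply: sup_upper_bound => //; exists t.
rewrite st2 => ub; rewrite -(ltrD2r (nrm (psum c g s) ^+ 2)) (le_lt_trans ub)//.
by rewrite -ltrBlDl.
Qed.

(** The partial isometry that maps [e i] to [g i] and vanishes on the orthogonal complement of all
    [e i]. *)
Definition transfer e g x : H :=
  lim (psum (fun i => inner x (e i)) g @ finite_supersets).

Lemma transfer_closed x e g (C : set H) (s : {fset I}) :
  orthonormal_family e -> orthonormal_family g -> closed C ->
  (forall t, (s `<=` t)%fset -> C (psum (fun i => inner x (e i)) g t)) ->
  C (transfer e g x).
Proof.
move=> eon gon Ccl Cs; have := psum_cvg (x := x) eon gon.
by apply: (closed_cvg C) => //; exists s.
Qed.

End riesz_fischer.

(** * Closed subspaces and closed linear spans *)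

Section closed_subspaces.
Context {R : realType} {H : hilbertType R}.
Implicit Types (M : set H) (x y : H).

Lemma subspace0 M : closed_subspace M -> M 0.
Proof. by move=> [_ [M0 _]]; exact/set_mem. Qed.

Lemma subspaceP M a x y : closed_subspace M -> M x -> M y -> M (a *: x + y).
Proof. by move=> [_ [_ ML]] /mem_set Mx /mem_set My; exact/set_mem/ML. Qed.

Lemma subspaceZ M a x : closed_subspace M -> M x -> M (a *: x).
Proof. by move=> Mcs Mx; rewrite -[_ *: _]addr0; apply: subspaceP => //; exact: subspace0. Qed.

Lemma subspaceD M x y : closed_subspace M -> M x -> M y -> M (x + y).
Proof. by move=> Mcs Mx; rewrite -[x]scale1r; exact: subspaceP. Qed.

Lemma subspaceB M x y : closed_subspace M -> M x -> M y -> M (x - y).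
Proof. by move=> Mcs Mx My; rewrite addrC -scaleN1r; exact: subspaceP. Qed.

Lemma subspace_sum M (J : eqType) (s : seq J) (F : J -> H) : closed_subspace M ->
  (forall j, j \in s -> M (F j)) -> M (\sum_(j <- s) F j).
Proof.
move=> Mcs MF; rewrite big_seq; elim/big_ind : _ => //; first exact: subspace0.
by move=> x y; exact: subspaceD.
Qed.

Lemma closed_subspace_ortho (A : set H) :
  closed_subspace [set x | forall y, A y -> inner x y = 0].
Proof.
have -> : [set x | forall y, A y -> inner x y = 0] =
    \bigcap_(y in A) [set x | inner x y = 0] by [].
split; first by apply: closed_bigI => y _; have [] := closed_ortho y.
split; first by rewrite mem_set// => y _ /=; rewrite inner0l.
move=> a u v /set_mem uA /set_mem vA; apply: mem_set => y Ay /=.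
by rewrite innerDl innerZl (uA _ Ay) (vA _ Ay) mulr0 addr0.
Qed.

Lemma closed_span_subspace (A : set H) : closed_subspace (closed_span A).
Proof.
split; first by apply: closed_bigI => M [[]].
split; first by rewrite mem_set// => M [/subspace0].
move=> a u v /set_mem uA /set_mem vA; apply: mem_set => M MA.
by apply: subspaceP; [case: MA|exact: uA|exact: vA].
Qed.

Lemma sub_closed_span (A : set H) : A `<=` closed_span A.
Proof. by move=> x Ax M [_]; exact. Qed.

Lemma closed_span_min (A M : set H) : closed_subspace M -> A `<=` M -> closed_span A `<=` M.
Proof. by move=> Mcs AM x; apply. Qed.

End closed_subspaces.

Record onfamily {R : realType} (H : hilbertType R) (I : choiceType) := OnFamily {
  onfun :> I -> H ;
  onfunP : orthonormal_family onfun }.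

Section transfer_operator.
Context {R : realType} {H : hilbertType R} {I : choiceType}.
Implicit Types (e g : onfamily H I) (x y : H).

Lemma inner_onfun e i j : inner (e i) (e j) = (i == j)%:R.
Proof. exact: onfunP. Qed.

Lemma nrm_onfun e i : nrm (e i) = 1.
Proof.
have := inner_onfun e i i; rewrite innerxx eqxx => /complexI/eqP.
by rewrite sqrp_eq1 ?nrm_ge0// => /eqP.
Qed.

Let T e g := transfer e g.

Let T_coef e g x i : inner (T e g x) (g i) = inner x (e i).
Proof.
apply: (transfer_closed (s := [fset i]%fset) (C := [set z | inner z (g i) = inner x (e i)])).
- exact: onfunP.
- exact: onfunP.
- exact: closed_inner_eq.
- by move=> t; rewrite fsub1set /= => it; rewrite (inner_psum _ _ _ (onfunP g)) it.
Qed.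

Let T_in e g x C : closed_subspace C -> (forall i, inner x (e i) <> 0 -> C (g i)) ->
  C (T e g x).
Proof.
move=> Ccs Cg; apply: (transfer_closed (s := fset0)).
- exact: onfunP.
- exact: onfunP.
- by case: Ccs.
- move=> t _; apply: subspace_sum => // i _.
  have [->|/eqP/Cg Cgi] := eqVneq (inner x (e i)) 0; last exact: subspaceZ.
  by rewrite scale0r; exact: subspace0.
Qed.

Let T_le e g x : nrm (T e g x) <= nrm x.
Proof.
apply: (transfer_closed (s := fset0) (C := [set z | nrm z <= nrm x])).
- exact: onfunP.
- exact: onfunP.
- exact: closed_nrm_le.
- move=> t _ /=; rewrite -(nrm_psum _ _ (onfunP e))//; last exact: onfunP.
  exact: (bessel _ _ (onfunP e)).
Qed.

Lemma span_onfun_eq0 g z : closed_span (range g) z ->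
  (forall i, inner z (g i) = 0) -> z = 0.
Proof.
move=> gz zg; apply: innerxx_eq0.
apply: (closed_span_min (closed_ortho z) _ gz) => _ [i _ <-].
exact/inner_eq0C/zg.
Qed.

Let T_span e g x : closed_span (range g) (T e g x).
Proof.
apply: (@T_in e g x (closed_span _)) => [|i _]; first exact: closed_span_subspace.
by apply: sub_closed_span; exists i.
Qed.

Lemma span_onfun_inj g x y : closed_span (range g) x -> closed_span (range g) y ->
  (forall i, inner x (g i) = inner y (g i)) -> x = y.
Proof.
move=> gx gy xy; apply/eqP; rewrite -subr_eq0; apply/eqP/(@span_onfun_eq0 g).
  exact: (subspaceB (closed_span_subspace _)).
by move=> i; rewrite innerBl xy subrr.
Qed.

Lemma transfer_bounded e g : transfer e g \in is_bounded_op.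
Proof.
apply/is_bounded_opP; split; last first.
  by exists 1 => x; rewrite mul1r !nrmE lecR T_le.
move=> a x y; apply: (@span_onfun_inj g).
- exact: T_span.
- by apply: (subspaceP _ (closed_span_subspace _)); exact: T_span.
- by move=> i; rewrite innerDl innerZl ![inner (transfer _ _ _) _]T_coef innerDl innerZl.
Qed.

Definition xfer e g : bounded_op H := BoundedOp (transfer_bounded e g).

Lemma xfer_coef e g x i : inner (xfer e g x) (g i) = inner x (e i).
Proof. exact: T_coef. Qed.

(** Only indices with a nonzero coefficient matter. This is how transfers are shown to lie in the
    nest algebra: for [x] in a nest element, every [e i] orthogonal to that element drops out. *)
Lemma xfer_in e g x C : closed_subspace C ->
  (forall i, inner x (e i) <> 0 -> C (g i)) -> C (xfer e g x).
Proof. exact: T_in. Qed.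

Lemma nrm_xfer e g x : nrm (xfer e g x) <= nrm x.
Proof. exact: T_le. Qed.

Lemma xfer_span e g x : closed_span (range g) (xfer e g x).
Proof. exact: T_span. Qed.

Lemma xfer_ortho e g x y : (forall i, inner (g i) y = 0) -> inner (xfer e g x) y = 0.
Proof. by move=> gy; apply: (xfer_in (closed_ortho y)) => i _; exact: gy. Qed.

Lemma xfer_eq0 e g x : (forall i, inner x (e i) = 0) -> xfer e g x = 0.
Proof.
by move=> xe; apply: (@span_onfun_eq0 g); [exact: xfer_span|move=> i; rewrite xfer_coef].
Qed.

Lemma xfer_comp e g h x : xfer g h (xfer e g x) = xfer e h x.
Proof.
by apply: (@span_onfun_inj h) => [||i]; rewrite ?xfer_coef//; exact: xfer_span.
Qed.

Lemma xfer_proj e x i : inner (x - xfer e e x) (e i) = 0.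
Proof. by rewrite innerBl xfer_coef subrr. Qed.

End transfer_operator.

(** * Orthonormal bases and orthogonal projections *)

Section projection.
Context {R : realType} {H : hilbertType R}.
Implicit Types (M : set H) (x y : H).

Definition orthonormal_set (F : set H) :=
  forall x y, F x -> F y -> inner x y = (x == y)%:R.

Lemma orthonormal_set_family (F : set H) : orthonormal_set F ->
  orthonormal_family (fun i : {x | x \in F} => sval i).
Proof.
by move=> Fon i j; rewrite Fon ?(inj_eq val_inj)//; exact/set_mem/valP.
Qed.

Definition onset (F : set H) (Fon : orthonormal_set F) :=
  OnFamily (orthonormal_set_family Fon).

(** Zorn on the orthonormal subsets of [M]: a nonzero vector orthogonal to a maximal one could be
    normalised and added. *)
Lemma orthonormal_basis M : closed_subspace M -> exists F : set H,
  [/\ F `<=` M, orthonormal_set F &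
    forall x, M x -> (forall f, F f -> inner x f = 0) -> x = 0].
Proof.
move=> Mcs; have [|F [[FM Fon] Fmax]] :=
    @Zorn_bigcup H [set F | F `<=` M /\ orthonormal_set F].
  move=> S SP Stot; split; first by move=> x [F /SP[FM _] /FM].
  move=> x y [F SF Fx] [G SG Gy].
  have [FG|GF] := Stot _ _ SF SG.
    by have [_] := SP _ SG; apply => //; exact: FG.
  by have [_] := SP _ SF; apply => //; exact: GF.
exists F; split=> // x Mx xF; apply: contrapT => /eqP x0.
pose u := (`|x|^-1 : R[i]) *: x.
have uF f : F f -> inner u f = 0 by move=> Ff; rewrite /u innerZl xF// mulr0.
have uu : inner u u = 1.
  by rewrite -normr_inner /u normrZ normfV normr_id mulVf ?expr1n// normr_eq0.
have Fu : ~ F u by move=> /uF/eqP; rewrite uu oner_eq0.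
apply: (Fmax (F `|` [set u])).
  split; first by move=> y Fy; left.
  by move=> /(_ u (or_intror erefl)).
split; first by move=> y [/FM//|->]; exact: subspaceZ.
move=> y z [Fy|->] [Fz|->].
- exact: Fon.
- by rewrite inner_eq0C ?uF//; case: eqVneq Fy => [->|].
- by rewrite uF//; case: eqVneq Fz => [<-|].
- by rewrite uu eqxx.
Qed.

Definition is_projection M (P : bounded_op H) :=
  forall x, M (P x) /\ forall y, M y -> inner (x - P x) y = 0.

Lemma projection_exists M : closed_subspace M -> exists P, is_projection M P.
Proof.
move=> Mcs; have [F [FM Fon Ftot]] := orthonormal_basis Mcs.
pose e := onset Fon.
have PM x : M (xfer e e x) by apply: xfer_in => // i _; exact/FM/set_mem/valP.
exists (xfer e e) => x; split=> // y My.
(* [xfer e e] fixes [M] pointwise: the difference lies in [M] and is orthogonal to the basis [F]. *)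
have <- : xfer e e y = y.
  apply/esym/eqP; rewrite -subr_eq0; apply/eqP/Ftot; first exact: subspaceB.
  by move=> f Ff; exact: (xfer_proj e y (SigSub (mem_set Ff))).
by apply/inner_eq0C/xfer_ortho => i; exact/inner_eq0C/xfer_proj.
Qed.

End projection.

Section bounded_op_additive.
Context {R : realType} {H : hilbertType R}.
Implicit Types (T : bounded_op H) (x y : H).

Lemma bop0r T : T 0 = 0. Proof. exact: linear0. Qed.

Lemma bopDr T x y : T (x + y) = T x + T y. Proof. exact: linearD. Qed.

Lemma bopBr T x y : T (x - y) = T x - T y. Proof. exact: linearB. Qed.

Lemma bop_sumr T (J : Type) (s : seq J) (P : pred J) (F : J -> H) :
  T (\sum_(j <- s | P j) F j) = \sum_(j <- s | P j) T (F j).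
Proof. exact: linear_sum. Qed.

End bounded_op_additive.

(** * Density of unimodular tuples *)

Section operator_bounds.
Context {R : realType} {H : hilbertType R} {N : nest H}.
Implicit Types (S T : nest_alg N) (K : set H).

Definition opn T : R := complex.Re `|T|.

Lemma opn_ge0 T : 0 <= opn T.
Proof. by rewrite -lecR /opn normr_Re normr_ge0. Qed.

Lemma nrm_op T x : nrm (T x) <= opn T * nrm x.
Proof.
rewrite -lecR rmorphM/= /opn normr_Re -!nrmE; exact: ler_normr_bop.
Qed.

Lemma nest_op_in T K x : N K -> K x -> K (T x).
Proof. by move=> NK Kx; have /nest_algebraP TN := valP T; exact: TN. Qed.

Lemma nest_op_suml n (F G : 'I_n -> nest_alg N) x :
  nest_op (\sum_i F i * G i) x = \sum_i F i (G i x).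
Proof.
pose ev (T : nest_alg N) := nest_op T x.
rewrite -[LHS]/(ev _) (big_morph ev (id1 := 0) (op1 := +%R))//.
Qed.

End operator_bounds.

Section density.
Context {R : realType} {H : hilbertType R} {N : nest H}.

Lemma dense_close n (S : set 'rV[nest_alg N]_n) (a0 : 'I_n -> nest_alg N) (d : R) :
  dense S -> 0 < d -> exists2 a, S a &
    forall i x, nrm (a ord0 i x - a0 i x) <= d * nrm x.
Proof.
move=> Sd d0; pose r : 'rV[nest_alg N]_n := \row_i a0 i.
have d0C : 0 < d%:C :> R[i] by rewrite ltcR.
have [|a [/interior_subset ra Sa]] := Sd (ball r d%:C)^° _ (@open_interior _ _).
  exists r; exact: nbhsx_ballx.
exists a => // i x; have : ball (r ord0 i) d%:C (a ord0 i) by case: ra => _; exact.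
rewrite mxE -ball_normE /= => rai.
have {}rai : `|a ord0 i - a0 i| < d%:C by rewrite distrC.
apply: (le_trans (nrm_op (a ord0 i - a0 i) x)); rewrite ler_wpM2r ?nrm_ge0//.
by rewrite -lecR /opn normr_Re ltW.
Qed.

Lemma not_dense_right n (a0 : 'I_n -> nest_alg N) (d : R) : 0 < d ->
  (forall a b : 'I_n -> nest_alg N,
    (forall i x, nrm (a i x - a0 i x) <= d * nrm x) ->
    (forall x, \sum_i a i (b i x) = x) -> False) ->
  ~ dense (@right_unimodular R (nest_alg N) n).
Proof.
move=> d0 abF /(dense_close a0)/(_ d0)[a [b ab1] ad].
apply: (abF (a ord0) (b ord0) ad) => x; rewrite -nest_op_suml.
by have -> : \sum_i a ord0 i * b ord0 i = 1 by exact: ab1.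
Qed.

Lemma not_dense_left n (a0 : 'I_n -> nest_alg N) (d : R) : 0 < d ->
  (forall a b : 'I_n -> nest_alg N,
    (forall i x, nrm (a i x - a0 i x) <= d * nrm x) ->
    (forall x, \sum_i b i (a i x) = x) -> False) ->
  ~ dense (@left_unimodular R (nest_alg N) n).
Proof.
move=> d0 abF /(dense_close a0)/(_ d0)[a [b ab1] ad].
apply: (abF (a ord0) (b ord0) ad) => x; rewrite -nest_op_suml.
by have -> : \sum_i b ord0 i * a ord0 i = 1 by exact: ab1.
Qed.

Lemma rtsr_infty : (forall n, (0 < n)%N -> ~ dense (@right_unimodular R (nest_alg N) n)) ->
  rtsr (nest_alg N) = +oo%E.
Proof.
move=> nd; rewrite /rtsr; set E := (X in ereal_inf X).
have -> : E = set0 by apply/seteqP; split=> // y [n [n0 dn] _]; case: (nd n n0 dn).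
exact: ereal_inf0.
Qed.

Lemma ltsr_infty : (forall n, (0 < n)%N -> ~ dense (@left_unimodular R (nest_alg N) n)) ->
  ltsr (nest_alg N) = +oo%E.
Proof.
move=> nd; rewrite /ltsr; set E := (X in ereal_inf X).
have -> : E = set0 by apply/seteqP; split=> // y [n [n0 dn] _]; case: (nd n n0 dn).
exact: ereal_inf0.
Qed.

End density.

Section reindexing.
Context {R : realType} {H : hilbertType R} {I J : choiceType}.

Lemma orthonormal_family_comp (f : onfamily H I) (s : J -> I) : injective s ->
  orthonormal_family (f \o s).
Proof. by move=> sI i j; rewrite /= inner_onfun (inj_eq sI). Qed.

Definition reindex (f : onfamily H I) (s : J -> I) (sI : injective s) :=
  OnFamily (orthonormal_family_comp f sI).

End reindexing.

(** * A self-similar interval *)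

Section interval_basis.
Context {R : realType} {H : hilbertType R} (N : nest H) {I : choiceType}.
Variables (M L : set H) (NM : N M) (NL : N L) (LM : L `<=` M) (f : onfamily H I).

(** The last clause is totality: [f] is an orthonormal basis of $M \ominus L$. *)
Definition interval_basis :=
  [/\ forall i, M (f i), forall i y, L y -> inner (f i) y = 0 &
    forall x, M x -> (forall y, L y -> inner x y = 0) ->
      (forall i, inner x (f i) = 0) -> x = 0].

Hypothesis fML : interval_basis.
Let Mcs : closed_subspace M := nest_subspace NM.
Let Lcs : closed_subspace L := nest_subspace NL.
(** The orthogonal projection onto $M \ominus L$. *)
Let P := xfer f f.

Let fM i : M (f i). Proof. by case: fML. Qed.
Let fL i y : L y -> inner (f i) y = 0. Proof. by case: fML => _ + _; exact. Qed.

Let PM x : M (P x).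
Proof. by apply: xfer_in. Qed.

Let PL0 x : L x -> P x = 0.
Proof. by move=> Lx; apply: xfer_eq0 => i; exact/inner_eq0C/fL. Qed.

Let subPL x : M x -> L (x - P x).
Proof.
move=> Mx; have [Q QL] := projection_exists Lcs.
set v := x - P x; have [LQv vQ] := QL v.
suff : v - Q v = 0 by move/eqP; rewrite subr_eq0 => /eqP ->.
have [_ _ ftot] := fML; apply: ftot => //.
  by apply: subspaceB => //; [exact: subspaceB|exact: LM].
by move=> i; rewrite innerBl xfer_proj sub0r (inner_eq0C (fL i LQv)) oppr0.
Qed.

(** Intervals are semi-invariant: [T] keeps the component of [x] in [L] inside [L], which [P] kills.
    Compression by [P] is thus multiplicative on the nest algebra. *)
Let P_semi (T : nest_alg N) x : M x -> P (T x) = P (T (P x)).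
Proof.
move=> Mx; apply/eqP; rewrite -subr_eq0 -bopBr -bopBr PL0//.
by apply: nest_op_in => //; exact: subPL.
Qed.

Variables (n : nat) (w : 'I_n -> I -> I) (wI : forall a, injective (w a)).
Hypothesis w_disj : forall a b i j, w a i = w b j -> a = b.
Variable i0 : I.
Hypothesis w_i0 : forall a i, w a i <> i0.

(** Small enough that [n] errors of relative size [d] add up to at most one half; [n.+1] keeps [d]
    positive for [n = 0]. *)
Let d : R := (2 * n.+1%:R)^-1.
Let d0 : 0 < d. Proof. by rewrite invr_gt0 mulr_gt0. Qed.

Let sum_d (F : 'I_n -> R) : 0 <= \sum_b F b ->
  \sum_(a < n) (d * \sum_b F b) <= (\sum_b F b) / 2.
Proof.
move=> F0; rewrite sumr_const card_ord -[_ *+ n]mulr_natl mulrA mulrC ler_wpM2l//.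
rewrite /d invfM mulrCA ler_piMr// ?invr_ge0// ler_pdivrMr// mul1r ler_nat//.
Qed.

Let xfer_disj a b x :
  xfer (reindex f (@wI a)) f (xfer f (reindex f (@wI b)) x) = if a == b then P x else 0.
Proof.
have [->|ab] := eqVneq a b; first by rewrite xfer_comp.
apply: xfer_eq0 => i; apply: xfer_ortho => j /=; rewrite inner_onfun.
by case: eqP => // /w_disj ba; rewrite ba eqxx in ab.
Qed.

(* Starting from [z = f i0], the iteration [z -> z - \sum_b W b (P (a b z))]
   halves the size of [P \o a] at [z] but keeps the coefficient of [z] on [f i0],
   so that [P \o a] is not bounded below. *)
Lemma left_unimodular_not_dense
  (cw : forall a, xfer (reindex f (@wI a)) f \in nest_algebra N) :
  ~ dense (@left_unimodular R (nest_alg N) n).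
Proof.
apply: (@not_dense_left _ _ _ _ (fun a => NestAlg (cw a)) d) => // a b.
set a0 := fun c : 'I_n => NestAlg (cw c) => ad ba.
pose r c z := P (a c z).
pose W c := xfer f (reindex f (@wI c)).
pose rho z := \sum_c nrm (r c z).
have rho_ge0 z : 0 <= rho z by apply: sumr_ge0 => c _; exact: nrm_ge0.
pose K := \sum_c opn (b c).
have K0 : 0 <= K by apply: sumr_ge0 => c _; exact: opn_ge0.
(* Semi-invariance inserts [P] between [b c] and [a c], which bounds [P z], of norm at least 1, by
   [K * rho z]. *)
have low z : M z -> inner z (f i0) = 1 -> 1 <= K * rho z.
  move=> Mz zi0; have Pz : P z = \sum_c P (b c (r c z)).
    rewrite -{1}(ba z) bop_sumr; apply: eq_bigr => c _.
    exact: (P_semi _ (nest_op_in _ NM Mz)).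
  apply: (@le_trans _ _ (nrm (P z))).
    have := cauchy_schwarz (P z) (nrm_onfun f i0).
    by rewrite xfer_coef zi0 normr1 nrmE -lecR.
  rewrite Pz (le_trans (nrm_sum _ _ _))// /K mulr_suml; apply: ler_sum => c _.
  apply: (le_trans (nrm_xfer _ _ _)); apply: (le_trans (nrm_op _ _)).
  rewrite ler_wpM2l ?opn_ge0// /rho (bigD1 c)//= lerDl.
  by apply: sumr_ge0 => e _; exact: nrm_ge0.
have step z : M z -> inner z (f i0) = 1 ->
    exists z', [/\ M z', inner z' (f i0) = 1 & rho z' <= rho z / 2].
  move=> Mz zi0; pose z' := z - \sum_c W c (r c z); exists z'; split.
  - apply: (subspaceB Mcs) => //; apply: (subspace_sum Mcs) => c _.
    by apply: (xfer_in Mcs) => i _; exact: fM.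
  - rewrite innerBl zi0 inner_suml big1 ?subr0// => c _.
    apply: xfer_ortho => i /=; rewrite inner_onfun.
    by case: eqP => // /w_i0.
  (* [a0 c] recovers [r c z] from the correction, so only the perturbations [a c - a0 c] contribute
     to [r c z']. *)
  - have rz' c : r c z' = - \sum_e P (a c (W e (r e z)) - a0 c (W e (r e z))).
      have -> : \sum_e P (a c (W e (r e z)) - a0 c (W e (r e z))) =
          P (\sum_e (a c (W e (r e z)) - a0 c (W e (r e z)))) by rewrite bop_sumr.
      have a0W : \sum_e a0 c (W e (r e z)) = r c z.
        have a0Wf e v : a0 c (W e v) = if c == e then P v else 0 by exact: xfer_disj.
        rewrite (bigD1 c) // a0Wf eqxx big1; last first.
          by move=> e ec; rewrite a0Wf eq_sym (negbTE ec).
        by rewrite /= addr0; exact: xfer_comp.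
      rewrite sumrB -bop_sumr a0W bopBr opprB /r /z' bopBr bopBr.
      by rewrite [P (P _)]xfer_comp.
    apply: le_trans (sum_d (rho_ge0 z)); apply: ler_sum => c _.
    rewrite rz' nrmN (le_trans (nrm_sum _ _ _))// mulr_sumr; apply: ler_sum => e _.
    rewrite (le_trans (nrm_xfer _ _ _))// (le_trans (ad _ _))//.
    by rewrite ler_wpM2l ?(ltW d0)// nrm_xfer.
(* Halving gives geometric decay; the weaker rate [1 / k.+1] already contradicts [low]. *)
have iter k : exists z, [/\ M z, inner z (f i0) = 1 & rho z <= rho (f i0) / k.+1%:R].
  elim: k => [|k [z [Mz zi0 zk]]].
    by exists (f i0); split => //; rewrite ?inner_onfun ?eqxx// divr1.
  have [z' [Mz' zi0' z'k]] := step z Mz zi0; exists z'; split=> //.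
  apply: (le_trans z'k); rewrite ler_pdivrMr// (le_trans zk)// -mulrA.
  by rewrite ler_wpM2l// ler_pdivlMl// ler_pdivrMr// -natrM ler_nat; lia.
have [z [Mz zi0 zk]] := iter (Num.truncn (K * rho (f i0))).
have := low z Mz zi0; apply/negP; rewrite -ltNge.
apply: (@le_lt_trans _ _ (K * (rho (f i0) / (Num.truncn (K * rho (f i0))).+1%:R))).
  by rewrite ler_wpM2l.
rewrite mulrA ltr_pdivrMr// mul1r; apply: truncnS_gt.
Qed.

(** The vector [x = f i0] is orthogonal to the ranges of all [a0 c]. Applying their adjoints [S c]
    to the compressed identity [\sum_c a c (b c x) = x] expresses each [y c] by the errors [D e]
    alone. Hence [t <= t / 2], all [y c] vanish and so does [P x], against its coefficient 1 on
    [f i0]. *)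
Lemma right_unimodular_not_dense
  (cw : forall a, xfer f (reindex f (@wI a)) \in nest_algebra N) :
  ~ dense (@right_unimodular R (nest_alg N) n).
Proof.
apply: (@not_dense_right _ _ _ _ (fun a => NestAlg (cw a)) d) => // a b.
set a0 := fun c : 'I_n => NestAlg (cw c) => ad ab.
pose x := f i0; pose y c := P (b c x).
have Mbx c : M (b c x) by apply: (nest_op_in _ NM); exact: fM.
have Px : P x = \sum_c P (a c (y c)).
  by rewrite -{1}(ab x) bop_sumr; apply: eq_bigr => c _; exact: P_semi.
pose D c := a c (y c) - a0 c (y c).
have {}Px : P x = \sum_c P (a0 c (y c)) + \sum_c P (D c).
  rewrite Px -big_split; apply: eq_bigr => c _.
  have -> : a c (y c) = a0 c (y c) + D c by rewrite addrC subrK.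
  exact: (bopDr P (a0 c (y c)) (D c)).
have DE c : nrm (D c) <= d * nrm (y c) by exact: ad.
pose S c := xfer (reindex f (@wI c)) f.
have Sa0 c e v : S c (a0 e v) = if c == e then P v else 0 by exact: xfer_disj.
have SP c v : S c (P v) = S c v.
  apply/eqP; rewrite -subr_eq0 -bopBr; apply/eqP/xfer_eq0 => i.
  by rewrite innerBl /= xfer_coef subrr.
have yc c : y c = - \sum_e S c (D e).
  have : S c (P x) = 0.
    by rewrite SP; apply: xfer_eq0 => i /=; rewrite inner_onfun eq_sym; case: eqP => // /w_i0.
  have -> : S c (P x) = y c + \sum_e S c (D e).
    rewrite Px bopDr !bop_sumr (bigD1 c) // big1; last first.
      by move=> e ec; apply: etrans (SP _ _) _; rewrite Sa0 eq_sym (negbTE ec).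
    rewrite SP Sa0 eqxx; congr (_ + _); first by rewrite [LHS]addr0; exact: xfer_comp.
    by apply: eq_bigr => e _; rewrite SP.
  by move/eqP; rewrite addr_eq0 => /eqP.
pose t := \sum_c nrm (y c).
have t0 : 0 <= t by apply: sumr_ge0 => c _; exact: nrm_ge0.
have : t <= t / 2.
  apply: le_trans (sum_d t0); apply: ler_sum => c _.
  rewrite yc nrmN (le_trans (nrm_sum _ _ _))// mulr_sumr; apply: ler_sum => e _.
  by rewrite (le_trans (nrm_xfer _ _ _)).
rewrite ler_pdivlMr// mulr_natr mulr2n gerDl => tle.
have {tle}t0' : t = 0 by apply/eqP; rewrite eq_le tle.
have yc0 c : y c = 0.
  apply: nrm0_eq0; move/eqP: t0'; rewrite psumr_eq0 => [|e _]; last exact: nrm_ge0.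
  by move=> /allP/(_ c (mem_index_enum c))/eqP.
have : inner (P x) (f i0) = 1 by rewrite xfer_coef inner_onfun eqxx.
rewrite Px -big_split big1 ?inner0l => [/eqP|c _]; first by rewrite eq_sym oner_eq0.
rewrite /D yc0 !bop0r subr0 !bop0r; exact: addr0.
Qed.

End interval_basis.

(** * A sequence of separable blocks *)

Section interleaving.
Variable n : nat.

(** Copy [a] of each block inside itself, on the indices of residue [a] modulo [n]. *)
Definition interleave (a : 'I_n) (p : nat * nat) : nat * nat := (p.1, (p.2 * n + a)%N).

Lemma interleave_inj2 a b p q : interleave a p = interleave b q -> a = b /\ p = q.
Proof.
case: p q => [i k] [j l] [-> kl]; have n0 : (0 < n)%N by apply: leq_ltn_trans (ltn_ord a).
have ab : a = b.
  apply: val_inj; rewrite /= -(modn_small (ltn_ord a)) -(modnMDl k) kl.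
  by rewrite modnMDl modn_small.
split=> //; move: kl; rewrite ab => /addIn/eqP; rewrite eqn_pmul2r// => /eqP -> //.
Qed.

Lemma interleave_inj a : injective (interleave a).
Proof. by move=> p q /interleave_inj2[]. Qed.

Definition next_block (p : nat * nat) : nat * nat := (p.1.+1, p.2).

Lemma next_block_inj : injective next_block.
Proof. by move=> [i k] [j l] [-> ->]. Qed.

Lemma next_interleave_inj a : injective (next_block \o interleave a).
Proof. exact: (inj_comp next_block_inj (@interleave_inj a)). Qed.

End interleaving.

Section block_basis.
Context {R : realType} {H : hilbertType R} (N : nest H).
Variables (B : nat -> set H) (f : onfamily H (nat * nat)%type).

(* [f (i, k)], [k : nat], is an orthonormal basis of [B i.+1 \ominus B i]. *)
Definition block_basis :=
  [/\ forall i, N (B i), forall i, B i `<=` B i.+1,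
    forall i k, B i.+1 (f (i, k)),
    forall i k y, B i y -> inner (f (i, k)) y = 0 &
    forall x, (forall y, B 0 y -> inner x y = 0) ->
      (forall p, inner x (f p) = 0) -> forall j y, B j y -> inner x y = 0].

Hypothesis Bf : block_basis.
Let NB i : N (B i). Proof. by case: Bf. Qed.
Let BS i : B i `<=` B i.+1. Proof. by case: Bf. Qed.
Let fB i k : B i.+1 (f (i, k)). Proof. by case: Bf. Qed.
Let fB0 i k y : B i y -> inner (f (i, k)) y = 0. Proof. by case: Bf => _ _ _ + _; exact. Qed.
Let Bcs i : closed_subspace (B i) := nest_subspace (NB i).

Lemma block_basis_le i j : (i <= j)%N -> B i `<=` B j.
Proof.
move=> /subnK <-; elim: (j - i)%N => // k IH.
by rewrite addSn; exact: subset_trans (@BS _).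
Qed.

(** The operator moves [f (s j)] one block down to [f (t j)]. A nest element either lies in
    [B (t j).1.+1], to which [f (s j)] is orthogonal, or contains it and therefore [f (t j)]. *)
Lemma block_xfer_nest (J : choiceType) (s t : J -> nat * nat)
    (sI : injective s) (tI : injective t) :
  (forall j, (s j).1 = (t j).1.+1) ->
  xfer (reindex f sI) (reindex f tI) \in nest_algebra N.
Proof.
move=> st; apply/nest_algebraP => K NK x Kx.
apply: (xfer_in (nest_subspace NK)) => j /= xj.
have fs : f (s j) = f ((t j).1.+1, (s j).2) by rewrite -st -surjective_pairing.
have ft : f (t j) = f ((t j).1, (t j).2) by rewrite -surjective_pairing.
have [KB|BK] := nest_chain NK (NB (t j).1.+1).
  by case: xj; rewrite fs; apply/inner_eq0C/fB0/KB.
by rewrite ft; exact/BK/fB.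
Qed.

(** All blocks together form one interval from [B 0] to [M]. The maps [next_block \o interleave a]
    miss block 0, which leaves [(0, 0)] as the free index, and the coisometries lower the blocks by
    one. *)
Lemma left_blocks_not_dense n : ~ dense (@left_unimodular R (nest_alg N) n).
Proof.
pose M := closed_span (\bigcup_(K in range B) K).
have NM : N M by apply: nest_span => _ [i _ <-].
have BM i : B i `<=` M.
  by apply: subset_trans (@sub_closed_span _ _ _); apply: bigcup_sup; exists i.
have fM : interval_basis M (B 0) f.
  split=> [[i k]|[i k] y B0y|x Mx xB0 xf]; first by apply: (BM i.+1); exact: fB.
    by apply: fB0; exact: block_basis_le B0y.
  have [_ _ _ _ /(_ x xB0 xf) xB] := Bf; apply: innerxx_eq0.
  apply: (closed_span_min (closed_ortho x) _ Mx) => y [_ [j _ <-] Bjy].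
  exact/inner_eq0C/xB/Bjy.
apply: (left_unimodular_not_dense NM (NB 0) (BM 0) fM (wI := @next_interleave_inj n)
  _ (i0 := (0%N, 0%N))) => //.
- by move=> a b p q /= /next_block_inj/interleave_inj2[].
- by move=> a; apply: block_xfer_nest.
Qed.

(** * Rows near isometries that lower the blocks by one *)

Section right_blocks.
Variable n : nat.
Let tI := @interleave_inj n.
(** Chosen so that [n.+1 * d = 1 / 4], the factor in the recursion for [t] below. *)
Let d : R := (4 * n.+1%:R)^-1.
Let d0 : 0 < d. Proof. by rewrite invr_gt0 mulr_gt0. Qed.
(** The adjoint of [a0 a] below; it raises the blocks by one. *)
Let S a := xfer (reindex f (@tI a)) (reindex f next_block_inj).

Let shift_nest a : xfer (reindex f next_block_inj) (reindex f (@tI a)) \in nest_algebra N.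
Proof. by apply: block_xfer_nest. Qed.

Let a0 a := NestAlg (shift_nest a).

Let Sa0 a b x : S a (a0 b x) =
  if a == b then xfer (reindex f next_block_inj) (reindex f next_block_inj) x else 0.
Proof.
have [->|ab] := eqVneq a b; first exact: xfer_comp.
apply: xfer_eq0 => p; apply: xfer_ortho => q /=; rewrite inner_onfun.
by case: eqP => // /interleave_inj2[ba]; rewrite ba eqxx in ab.
Qed.

Let S_block a m x : B m x -> B m.+1 (S a x).
Proof.
move=> Bx; apply: xfer_in => // -[i k] /= xi; have [im|mi] := ltnP i m.
  by apply: (block_basis_le (i := i.+2)) => //; rewrite /next_block /=; exact: fB.
by case: xi; apply/inner_eq0C/fB0/(block_basis_le mi).
Qed.

Let a0_block a m x : B m.+1 x -> B m (a0 a x).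
Proof.
move=> Bx; apply: xfer_in => // -[i k] /= xi; have [im|mi] := ltnP i m.
  by apply: (block_basis_le im); exact: fB.
by case: xi; apply/inner_eq0C/fB0/(block_basis_le _ Bx).
Qed.

(* Modulo [B 1], the family [f \o next_block] is an orthonormal basis. *)
Let next_proj s y : B s y ->
  B 1 (y - xfer (reindex f next_block_inj) (reindex f next_block_inj) y).
Proof.
move=> By; set v := y - _; have [Q QB] := projection_exists (Bcs 1).
have [BQv vQ] := QB v.
have Bv : B s.+1 v.
  apply: (subspaceB (Bcs _)); first exact: BS.
  apply: (xfer_in (Bcs _)) => -[i k] /= yi; apply/(@block_basis_le i.+2)/fB.
  rewrite ltnS ltnNge; apply/negP => si; apply: yi.
  exact/inner_eq0C/fB0/(block_basis_le (leqW si) By).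
have [_ _ _ _ tot] := Bf.
suff : v - Q v = 0 by move/eqP; rewrite subr_eq0 => /eqP ->.
apply: innerxx_eq0; apply: (tot _ _ _ s.+1).
- by move=> z B0z; apply/vQ/BS.
- move=> [[|i] k]; first exact/vQ/fB.
  rewrite innerBl (inner_eq0C (fB0 _ (block_basis_le _ BQv)))// subr0.
  exact: (xfer_proj (reindex f next_block_inj) y (i, k)).
- by apply: (subspaceB (Bcs _)) => //; exact: (block_basis_le _ BQv).
Qed.

(** A vector orthogonal to [B m] is the shortest one in its class modulo [B m]. *)
Let nrm_mod m u v : (forall y, B m y -> inner u y = 0) -> B m (u - v) -> nrm u <= nrm v.
Proof.
move=> uB Buv; apply: nrm_proj_le; apply: inner_eq0C.
by apply: uB; rewrite -opprB -scaleN1r; exact: (subspaceZ _ (Bcs m)).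
Qed.

(* If [\sum_a a a (b a x) = x] with [x = f (s, 0)], then the sizes [t m] of the
   parts of [b x] orthogonal to [B m] satisfy [t m.+1 <= n.+1 + t m / 4] and
   [4 * n.+1 <= t s], so that [t 0] is at least of order [s]. *)
Lemma right_blocks_not_dense : ~ dense (@right_unimodular R (nest_alg N) n).
Proof.
apply: (@not_dense_right _ _ _ _ a0 d) => // a b ad ab.
have [Q QB] := choice (fun m => projection_exists (Bcs m)).
have QBin m x : B m (Q m x) by case: (QB m x).
have Qort m x y : B m y -> inner (x - Q m x) y = 0 by case: (QB m x) => _; exact.
pose K := \sum_c opn (b c).
suff low s : s.+1%:R <= K.
  have := low (Num.truncn K); apply/negP; rewrite -ltNge; exact: truncnS_gt.
pose x := f (s, 0%N); pose y c := b c x.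
have Bx : B s.+1 x by exact: fB.
have By c : B s.+1 (y c) by exact: (nest_op_in _ (NB _)).
have x1 : nrm x = 1 by exact: nrm_onfun.
pose Y m c := y c - Q m (y c).
have BY m c : (m <= s.+1)%N -> B s.+1 (Y m c).
  by move=> ms; apply: (subspaceB (Bcs _)) => //; exact: (block_basis_le ms).
pose t m := \sum_c nrm (Y m c).
have t_ge0 m : 0 <= t m by apply: sumr_ge0 => c _; exact: nrm_ge0.
pose D m := \sum_c (a c (Y m c) - a0 c (Y m c)).
have DE m : nrm (D m) <= d * t m.
  by rewrite (le_trans (nrm_sum _ _ _))// mulr_sumr; apply: ler_sum => c _; exact: ad.
(* [B m] is invariant under each [a c], so modulo [B m] only the parts [Y m c] of [y c] count. *)
have xE m : B m (x - (\sum_c a0 c (Y m c) + D m)).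
  have -> : \sum_c a0 c (Y m c) + D m = \sum_c a c (Y m c).
    by rewrite -big_split; apply: eq_bigr => c _; rewrite /= addrC subrK.
  rewrite -{1}(ab x) -sumrB; apply: (subspace_sum (Bcs _)) => c _.
  by rewrite -bopBr /Y subKr; exact: (nest_op_in _ (NB _)).
(* Each [a0 c] lowers [B s.+1] into [B s], so modulo [B s] the unit vector [x] is carried by the
   error [D s] alone. *)
have ts : 4 * n.+1%:R <= t s.
  have : 1 <= d * t s.
    rewrite -x1 (le_trans _ (DE s))//; apply: (nrm_mod (m := s)) => [z Bz|].
      exact: fB0.
    have -> : x - D s = x - (\sum_c a0 c (Y s c) + D s) + \sum_c a0 c (Y s c).
      by rewrite opprD addrA addrAC subrK.
    apply: (subspaceD (Bcs _)) => //; apply: (subspace_sum (Bcs _)) => c _.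
    exact/a0_block/BY/leqnSn.
  by rewrite /d ler_pdivlMl ?mulr_gt0// mulr1.
have tS m : (m <= s)%N -> t m.+1 <= n.+1%:R + t m / 4.
  move=> ms; have tSc c : nrm (Y m.+1 c) <= 1 + d * t m.
    apply: (@le_trans _ _ (nrm (S c x - S c (D m)))); last first.
      apply: (le_trans (nrmD _ _)); rewrite nrmN lerD//.
        by rewrite -x1 nrm_xfer.
      exact: le_trans (nrm_xfer _ _ _) (DE m).
    apply: (nrm_mod (m := m.+1)) => [z Bz|]; first exact: Qort.
    pose v := \sum_e a0 e (Y m e).
    have Sv : S c v = xfer (reindex f next_block_inj) (reindex f next_block_inj) (Y m c).
      rewrite bop_sumr (bigD1 c) // Sa0 eqxx big1; last first.
        by move=> e ec; rewrite Sa0 eq_sym (negbTE ec).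
      exact: addr0.
    (* Each of the three summands lies in [B m.+1]: by the inclusion of [B m], by [next_proj], and
       by applying the raising operator [S c] to [xE m]. *)
    have -> : Y m.+1 c - (S c x - S c (D m)) =
        (Y m.+1 c - Y m c) + (Y m c - S c v) - S c (x - (v + D m)).
      rewrite !bopBr bopDr [_ + (Y m c - _)]addrA subrK !opprB.
      by rewrite -[S c v + _ - _]addrA [RHS]addrA subrK.
    apply: (subspaceB (Bcs _)); last exact: S_block.
    apply: (subspaceD (Bcs _)).
      have -> : Y m.+1 c - Y m c = Q m (y c) - Q m.+1 (y c) by rewrite /Y opprB addrC addrA subrK.
      by apply: (subspaceB (Bcs _)) => //; exact: BS.
    by rewrite Sv; apply: (block_basis_le (i := 1)) => //; exact/next_proj/BY/leqW.
  apply: (@le_trans _ _ (\sum_(c < n) (1 + d * t m))); first exact: ler_sum.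
  rewrite sumr_const card_ord -[_ *+ n]mulr_natl.
  apply: (@le_trans _ _ (n.+1%:R * (1 + d * t m))).
    by rewrite ler_wpM2r ?ler_nat// addr_ge0// mulr_ge0// ltW.
  have nd : n.+1%:R * d = 4^-1 by rewrite /d invfM mulrCA divff ?mulr1// pnatr_eq0.
  by rewrite mulrDr mulr1 lerD2l mulrA nd mulrC.
(* Read downwards, [tS] gives [t m >= 4 * (t m.+1 - n.+1)]. Starting from [ts] the growth is
   geometric; a linear bound is enough. *)
have tj j : (j <= s)%N -> 4 * n.+1%:R * j.+1%:R <= t (s - j)%N.
  elim: j => [|j IH] js; first by rewrite mulr1 subn0.
  have := IH (ltnW js); rewrite -subSS subSn// => tj.
  have := tS (s - j.+1)%N (leq_subr _ _).
  have : 0 <= n.+1%:R * (j.+1%:R - 1) :> R by rewrite mulr_ge0// subr_ge0 ler1n.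
  have : 0 <= n.+1%:R :> R by [].
  rewrite -[j.+2%:R]natr1; lra.
have t0K : t 0%N <= K.
  apply: ler_sum => c _; apply: (@le_trans _ _ (nrm (y c))).
    apply: nrm_proj_le; rewrite subKr; apply: inner_eq0C; exact: Qort.
  by rewrite (le_trans (nrm_op _ _))// x1 mulr1.
apply: le_trans t0K; have := tj s (leqnn s); rewrite subnn; apply: le_trans.
by rewrite ler_peMl// -natrM ler1n.
Qed.

End right_blocks.
End block_basis.

(** * Infinitely many disjoint copies of an infinite set *)

Section infinite_copies.

Lemma infinite_injection (T : Type) (A : set T) : infinite_set A ->
  exists g : nat -> T, injective g /\ forall k, A (g k).
Proof.
elim/Ppointed: T => T in A *.
  by move=> /infinite_setN0[x Ax]; move: Ax; rewrite emptyE.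
move=> /infiniteP/pcard_leP[g]; exists g; split; last by move=> k; exact: funS.
by move=> i j gij; apply: (inj (f := g)); rewrite ?inE.
Qed.

Context {J : choiceType}.

Let denumerable (X : set J) := infinite_set X /\ countable X.

(** A maximal family of pairwise disjoint denumerable sets leaves only a finite remainder, which is
    merged into one member [X0]. The set [blk i] is the class of [i]. *)
Lemma denumerable_partition : infinite_set [set: J] -> exists blk : J -> set J,
  forall i, [/\ denumerable (blk i), blk i i & forall j, blk i j -> blk j = blk i].
Proof.
move=> Iinf.
pose P (G : set (set J)) := (forall X, G X -> denumerable X) /\
  (forall X Y i, G X -> G Y -> X i -> Y i -> X = Y).
have [|G [[Gden Gdisj] Gmax]] := @Zorn_bigcup _ P.
  move=> S SP Stot; split; first by move=> X [G SG GX]; exact: (SP _ SG).1.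
  move=> X Y i [G SG GX] [G' SG' GY]; have [GG|GG] := Stot _ _ SG SG'.
    by apply: (SP _ SG').2 => //; exact: GG.
  by apply: (SP _ SG).2 => //; exact: GG.
pose rem := ~` (\bigcup_(X in G) X).
have remfin : finite_set rem.
  apply: contrapT => /infinite_injection[g [gI grem]].
  have ggrem X i : G X -> X i -> range g i -> False.
    by move=> GX Xi [k _ gk]; apply: (grem k); rewrite gk; exists X.
  apply: (Gmax (G `|` [set range g])).
    split; first by move=> X GX; left.
    by move=> /(_ _ (or_intror erefl)) Gg; apply: (ggrem _ (g 0%N) Gg); exists 0%N.
  split.
    move=> X [/Gden//|->]; have gE := inj_card_eq (in2W gI : {in [set: nat] &, injective g}).
    split; first by apply/infiniteP; rewrite (card_le_eqr gE).
    by rewrite (eq_countable gE).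
  move=> X Y i [GX|->] [GY|->] // Xi Yi; first exact: Gdisj Xi Yi.
    by case: (ggrem _ _ GX Xi Yi).
  by case: (ggrem _ _ GY Yi Xi).
have [X0 GX0] : G !=set0.
  apply: contrapT => /set0P/negP; rewrite negbK => /eqP G0.
  by apply: Iinf; move: remfin; rewrite /rem G0 bigcup_set0 setC0.
pose C := X0 `|` rem.
have Cden : denumerable C.
  split; first by apply: sub_infinite_set (Gden _ GX0).1 => x; left.
  rewrite /C -bigcup2E; apply: bigcup_countable => // -[|[|k]] _ //=.
    exact: (Gden _ GX0).2.
  exact: finite_set_countable.
have blkP i : exists X, [/\ denumerable X, X i & X = C \/ G X /\ X <> X0].
  have [Ci|nCi] := pselect (C i); first by exists C; split => //; left.
  have [X GX Xi] : (\bigcup_(X in G) X) i by apply: contrapT => ?; apply: nCi; right.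
  exists X; split => //; first exact: Gden.
  by right; split => // XX0; apply: nCi; left; rewrite -XX0.
have [blk blkE] := choice blkP; exists blk => i; have [bd bi bC] := blkE i.
split=> // j bij; have [_ bj bjC] := blkE j.
have GC X k : G X -> X <> X0 -> X k -> C k -> False.
  move=> GX XX0 Xk [X0k|]; first exact: (XX0 (Gdisj _ _ _ GX GX0 Xk X0k)).
  by apply; exists X.
case: bC bij => [->|[Gi Xi]] bij; case: bjC bj => [->|[Gj Xj]] bj //.
- by case: (GC _ _ Gj Xj bj bij).
- by case: (GC _ _ Gi Xi bij bj).
- exact: Gdisj bj bij.
Qed.

(** Within each class of the partition, the pair of [a] and the code of [i] is encoded as a natural
    number and sent back into the class. *)
Lemma infinite_copies : infinite_set [set: J] -> exists u : nat -> J -> J,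
  forall a b i j, u a i = u b j -> a = b /\ i = j.
Proof.
move=> Jinf; have [x0 _] := infinite_setN0 Jinf.
have [blk blkP] := denumerable_partition Jinf.
have codeP (X : set J) : exists cd : (J -> nat) * (nat -> J), denumerable X ->
    [/\ {in X &, injective cd.1}, injective cd.2 & forall k, X (cd.2 k)].
  have [[Xinf Xcnt]|nX] := pselect (denumerable X).
    have [d [dI dX]] := infinite_injection Xinf.
    have /countable_injP[c cI] := Xcnt.
    by exists (c, d).
  (* Dummy codes: only denumerable sets are ever coded. *)
  by exists (fun=> 0%N, fun=> x0).
have [cd cdP] := choice codeP.
pose u (a : nat) i := (cd (blk i)).2 (choice.pickle (a, (cd (blk i)).1 i)).
exists u => a b i j uij.
have [bi bii biE] := blkP i; have [bj bjj bjE] := blkP j.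
have [ci di dX] := cdP _ bi; have [_ _ dXj] := cdP _ bj.
have bij : blk j = blk i.
  have ui : blk i (u a i) by exact: dX.
  have uj : blk j (u a i) by rewrite uij; exact: dXj.
  by rewrite -(biE _ ui) (bjE _ uj).
move: uij; rewrite /u bij => /di/(pcan_inj choice.pickleK)[-> cij]; split => //.
by apply: ci => //; rewrite inE // -bij.
Qed.

End infinite_copies.

(** * Intervals and atoms of a nest *)

Section nest_structure.
Context {R : realType} {H : hilbertType R} (N : nest H).
Implicit Types (K L M : set H) (x y : H).

Definition ortho x K := forall y, K y -> inner x y = 0.

Lemma ortho_self x K : ortho x K -> K x -> x = 0.
Proof. by move=> xK Kx; exact/innerxx_eq0/xK. Qed.

Lemma orthogonal_difference_subspace M L : closed_subspace M ->
  closed_subspace (orthogonal_difference M L).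
Proof.
move=> Mcs; have Lcs := closed_subspace_ortho L; split.
  by apply: closedI; [case: Mcs|case: Lcs].
split.
  by rewrite mem_set//; split; [exact: subspace0|exact: (subspace0 Lcs)].
move=> a u v /set_mem[Mu Lu] /set_mem[Mv Lv]; apply: mem_set; split.
  exact: subspaceP.
exact: (subspaceP a Lcs).
Qed.

Lemma orthogonal_difference_split M L x : closed_subspace M -> closed_subspace L ->
  L `<=` M -> M x ->
  exists2 y, L y & orthogonal_difference M L (x - y).
Proof.
move=> Mcs Lcs LM Mx; have [Q QL] := projection_exists Lcs.
have [LQx xQ] := QL x; exists (Q x) => //; split=> //.
by apply: subspaceB => //; exact: LM.
Qed.

Lemma orthogonal_difference_neq0 M L : closed_subspace M -> closed_subspace L ->
  L `<` M -> exists2 x, orthogonal_difference M L x & x <> 0.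
Proof.
move=> Mcs Lcs [LM nML]; apply: contrapT => noE; apply: nML => x Mx.
have [y Ly Exy] := orthogonal_difference_split Mcs Lcs LM Mx.
have : x - y = 0 by apply: contrapT => xy0; apply: noE; exists (x - y).
by move/eqP; rewrite subr_eq0 => /eqP ->.
Qed.

Lemma orthogonal_difference_sub M L K : closed_subspace M -> closed_subspace L ->
  closed_subspace K -> L `<=` M -> L `<=` K -> orthogonal_difference M L `<=` K -> M `<=` K.
Proof.
move=> Mcs Lcs Kcs LM LK EK x Mx.
have [y Ly Exy] := orthogonal_difference_split Mcs Lcs LM Mx.
by rewrite -(subrK y x); apply: (subspaceD Kcs); [exact: EK|exact: LK].
Qed.

Lemma ortho_split M L x : closed_subspace M -> closed_subspace L -> L `<=` M ->
  ortho x L -> ortho x (orthogonal_difference M L) -> ortho x M.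
Proof.
move=> Mcs Lcs LM xL xE y My.
have [z Lz Eyz] := orthogonal_difference_split Mcs Lcs LM My.
by rewrite -(subrK z y) innerDr xE// xL// addr0.
Qed.

Let Ncs K (NK : N K) := nest_subspace NK.

(** If [L] were strictly below [L'], a nonzero vector of [L'] inside the interval would be
    orthogonal to [L']. This lets the ends chosen for an atom be compared with those supplied by
    [atom_lt]. *)
Lemma interval_bottom_sub M L M' L' : N M -> N L -> L `<` M -> N M' -> N L' -> L' `<` M' ->
  orthogonal_difference M L = orthogonal_difference M' L' -> L' `<=` L.
Proof.
move=> NM NL LM NM' NL' LM' EE'.
have [//|LL'] := nest_chain NL' NL; apply: contrapT => L'L.
have [ML'|L'M] := nest_chain NM NL'.
  have [z Ez] := orthogonal_difference_neq0 (Ncs NM) (Ncs NL) LM; apply.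
  have [Mz _] := Ez; move: Ez; rewrite EE' => -[_ zL'].
  by apply: (ortho_self zL'); exact: ML'.
have [z [L'z zL]] := orthogonal_difference_neq0 (Ncs NL') (Ncs NL) (conj LL' L'L); apply.
have : orthogonal_difference M L z by split=> //; exact: L'M.
by rewrite EE' => -[_ zL']; exact: (ortho_self zL').
Qed.

(** The well-order yields the least [K] to which [x] is not orthogonal. The join [L] of all elements
    strictly below [K] is still orthogonal to [x], so [L] is the immediate predecessor of [K]. *)
Lemma minimal_atom x K0 : nest_well_ordered N -> N K0 -> ~ ortho x K0 ->
  exists K L, [/\ N K, N L, L `<=` K, K `<=` K0 & atom N (orthogonal_difference K L)] /\
    ortho x L /\ ~ ortho x K.
Proof.
move=> wo NK0 xK0.
have [|K [NK xK] Kmin] := wo [set K | N K /\ ~ ortho x K] _ (ex_intro _ K0 (conj NK0 xK0)).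
  by move=> K [].
pose L := closed_span (\bigcup_(K' in [set K' | N K' /\ K' `<` K]) K').
have NL : N L by apply: nest_span => K' [].
have subL K' : N K' -> K' `<` K -> K' `<=` L.
  move=> NK' K'K; apply: subset_trans (@sub_closed_span _ _ _).
  by apply: bigcup_sup.
have LK : L `<=` K.
  by apply: closed_span_min; [exact: Ncs|apply: bigcup_sub => K' [_ []]].
have xL : ortho x L.
  move=> y Ly; apply: inner_eq0C.
  apply: (closed_span_min (closed_ortho x) _ Ly) => z [K' [NK' [K'K KK']]] K'z.
  apply: inner_eq0C; apply: contrapT => xz; apply: KK'; apply: Kmin; split=> //.
  by move=> /(_ z K'z).
have KL : ~ K `<=` L by move=> KL; apply: xK => y /KL; exact: xL.
exists K, L; do !split => //; first by apply: Kmin.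
  by exists K, L; split.
move=> F [M' [L' [NM' NL' L'M' ->]]] FE.
apply/seteqP; split=> //.
have [z Fz z0] := orthogonal_difference_neq0 (Ncs NM') (Ncs NL') L'M'.
have [M'z zL'] := Fz; have [Kz zL] := FE _ Fz.
have KM' : K `<=` M'.
  have [M'K|//] := nest_chain NM' NK; apply: contrapT => nKM'.
  apply: z0; apply: (ortho_self zL). exact: (subL M' NM' (conj M'K nKM') z M'z).
have L'L : L' `<=` L.
  have [L'K|KL'] := nest_chain NL' NK; last by case: z0; apply: (ortho_self zL'); exact: KL'.
  by apply: subL => //; split=> // KL'; apply: z0; apply: (ortho_self zL'); exact: KL'.
by move=> y [Ky yL]; split; [exact: KM'|move=> u /L'L; exact: yL].
Qed.

(** By minimality of the atom, a nest element either lies in [L], to which every [e j] is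
    orthogonal, or contains every [g j]. *)
Lemma xfer_atom_nest M L (J : choiceType) (e g : onfamily H J) :
  N M -> N L -> L `<=` M -> atom N (orthogonal_difference M L) ->
  (forall j, orthogonal_difference M L (e j)) ->
  (forall j, orthogonal_difference M L (g j)) -> xfer e g \in nest_algebra N.
Proof.
move=> NM NL LM [_ Emin] eE gE; apply/nest_algebraP => K NK x Kx.
apply: (xfer_in (Ncs NK)) => j xj.
have [Mg gL] := gE j.
have [KL|KL] := pselect (K `<=` L).
  by case: xj; apply: inner_eq0C; have [_] := eE j; apply; exact: KL.
have LK : L `<` K by split=> //; have [|//] := nest_chain NK NL.
have [KM|] := nest_chain NK NM; last by apply.
have EK : orthogonal_difference K L = orthogonal_difference M L.
  by apply: Emin; [exists K, L|move=> y [Ky yL]; split=> //; exact: KM].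
by have := gE j; rewrite -EK => -[].
Qed.

Lemma total_ortho (E F : set H) x : closed_subspace E ->
  (forall y, E y -> (forall f, F f -> inner y f = 0) -> y = 0) -> F `<=` E ->
  (forall f, F f -> inner x f = 0) -> ortho x E.
Proof.
move=> Ecs Ftot FE xF; have [Q QE] := projection_exists Ecs; have [EQ xQ] := QE x.
have Qx0 : Q x = 0.
  apply: Ftot => // f Ff; rewrite -[Q x](subKr x) innerBl xF// xQ ?subr0//.
  exact: FE.
by move=> y Ey; have := xQ y Ey; rewrite Qx0 subr0.
Qed.

End nest_structure.

(** * Nests of ordinal type at least $\omega^2$ *)

Section atom_dichotomy.
Context {R : realType} {H : hilbertType R} (N : nest H).

Lemma infinite_atom_not_dense (M L F : set H) n : N M -> N L -> L `<=` M ->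
  atom N (orthogonal_difference M L) -> F `<=` orthogonal_difference M L ->
  orthonormal_set F ->
  (forall x, orthogonal_difference M L x -> (forall f, F f -> inner x f = 0) -> x = 0) ->
  infinite_set F ->
  ~ dense (@left_unimodular R (nest_alg N) n) /\
  ~ dense (@right_unimodular R (nest_alg N) n).
Proof.
move=> NM NL LM Eat FE Fon Ftot Finf.
pose f := onset Fon.
have fE i : orthogonal_difference M L (f i) by exact/FE/set_mem/valP.
have fML : interval_basis M L f.
  split=> [i|i y Ly|x Mx xL xf]; [by case: (fE i)|by case: (fE i) => _; exact|].
  by apply: Ftot => // y Fy; exact: (xf (SigSub (mem_set Fy))).
have Iinf : infinite_set [set: {x | x \in F}].
  move=> Ifin; apply: Finf; have := finite_image sval Ifin; apply: sub_finite_set.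
  by move=> x Fx; exists (SigSub (mem_set Fx)).
have [u uI] := infinite_copies Iinf; have [i0 _] := infinite_setN0 Iinf.
(* Copies 1 to [n] serve as ranges; copy 0 supplies the missed index [u 0 i0]. *)
pose w (a : 'I_n) := u a.+1.
have wI a : injective (w a) by move=> i j /uI[].
have w_disj a b i j : w a i = w b j -> a = b by move=> /uI[[/val_inj]].
have w_i0 a i : w a i <> u 0%N i0 by move=> /uI[].
split.
- apply: (left_unimodular_not_dense NM NL LM fML (wI := wI) w_disj w_i0) => a.
  by apply: (xfer_atom_nest NM NL LM Eat) => j; exact: fE.
- apply: (right_unimodular_not_dense NM NL LM fML (wI := wI) w_disj w_i0) => a.
  by apply: (xfer_atom_nest NM NL LM Eat) => j; exact: fE.
Qed.

Context (A : Type) (r : rel A).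
Hypotheses (N_type : has_ordinal_type N r) (omega2_r : ordinal_le omega2 r).

Lemma omega2E i k j l : omega2 (i, k) (j, l) = (i < j)%N || ((i == j) && (k <= l)%N).
Proof.
have -> : omega2 (i, k) (j, l) = (i <= j)%N && ((j <= i)%N ==> (k <= l)%N) by [].
by case: ltngtP.
Qed.

(** Fixes end points for the atoms numbered by [omega2]. The last clause holds because these form an
    initial segment: every atom below a listed one is listed. *)
Lemma omega2_atoms : exists M L : nat * nat -> set H,
  [/\ forall p, [/\ N (M p), N (L p), L p `<` M p & atom N (orthogonal_difference (M p) (L p))],
    forall p q, omega2 p q -> p <> q -> M p `<=` L q &
    forall K K' q, N K -> N K' -> K' `<=` K -> K `<=` L q -> atom N (orthogonal_difference K K') ->
      exists p, orthogonal_difference (M p) (L p) = orthogonal_difference K K'].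
Proof.
have [_ [h [h' hK h'K] h_mono]] := N_type; have [g g_mono g_init] := omega2_r.
pose E p : {E | atom N E} := h (g p).
have EP p : exists ML : set H * set H, [/\ N ML.1, N ML.2, ML.2 `<` ML.1 &
    sval (E p) = orthogonal_difference ML.1 ML.2].
  by have [[M [L [NM NL LM EE]]] _] := svalP (E p); exists (M, L).
have [ML MLP] := choice EP.
have at_ p : atom N (orthogonal_difference (ML p).1 (ML p).2).
  by have [_ _ _ <-] := MLP p; exact: (svalP (E p)).
exists (fun p => (ML p).1), (fun p => (ML p).2); split.
- by move=> p; have [? ? ? _] := MLP p; split.
- move=> p q pq neq_pq; have [NM NL LM EpE] := MLP p; have [NM' NL' LM' EqE] := MLP q.
  have : atom_le (E p) (E q) by rewrite /E h_mono g_mono.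
  move=> /asboolP[Epq|].
    have : atom_le (E q) (E p) by apply/asboolP; left.
    rewrite /E h_mono g_mono => qp; case: neq_pq.
    by apply: (@le_anti _ (nat *l nat)%type); rewrite -/(omega2 p q) -/(omega2 q p) pq qp.
  (* [atom_lt] comes with its own end points; [interval_bottom_sub] relates them to the chosen
     ones. *)
  case=> M1 [L1 [M2 [L2 [[NM1 NL1 LM1] [NM2 NL2 LM2] Ep1 Eq2 M1L2]]]].
  apply: subset_trans (interval_bottom_sub NM' NL' LM' NM2 NL2 LM2 _); last by rewrite -EqE.
  apply: subset_trans M1L2.
  apply: (orthogonal_difference_sub (nest_subspace NM) (nest_subspace NL) (nest_subspace NM1)).
  + exact: properW LM.
  + apply: subset_trans (properW LM1).
    by apply: (interval_bottom_sub NM1 NL1 LM1 NM NL LM); rewrite -EpE.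
  + by rewrite -EpE Ep1 => x [].
- move=> K K' q NK NK' K'K KL Kat; have [NM NL LM EqE] := MLP q.
  have K'nK : K' `<` K.
    split=> // KK'; have [[M1 [L1 [NM1 NL1 LM1 E1]]] _] := Kat.
    have [z] := orthogonal_difference_neq0 (nest_subspace NM1) (nest_subspace NL1) LM1.
    by rewrite -E1 => -[/KK' K'z /ortho_self zK'] z0; apply/z0/zK'.
  have : atom_le (exist _ _ Kat) (E q).
    by apply/asboolP; right; exists K, K', (ML q).1, (ML q).2; split.
  rewrite -(h'K (exist _ _ Kat)) /E h_mono => /g_init[p gp]; exists p.
  by have [_ _ _ <-] := MLP p; rewrite /E gp h'K.
Qed.

Lemma unimodular_not_dense n :
  ~ dense (@left_unimodular R (nest_alg N) n) /\
  ~ dense (@right_unimodular R (nest_alg N) n).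
Proof.
have [M [L [MLP ML_lt ML_init]]] := omega2_atoms.
have wo : nest_well_ordered N by case: N_type.
have NM p : N (M p) by case: (MLP p).
have NL p : N (L p) by case: (MLP p).
have LM p : L p `<` M p by case: (MLP p).
have Mcs p := nest_subspace (NM p); have Lcs p := nest_subspace (NL p).
pose E p := orthogonal_difference (M p) (L p).
have Ecs p : closed_subspace (E p) by exact: orthogonal_difference_subspace.
have [F FP] := choice (fun p => orthonormal_basis (Ecs p)).
have FE p : F p `<=` E p by case: (FP p).
have Fon p : orthonormal_set (F p) by case: (FP p).
have Ftot p x : E p x -> (forall f, F p f -> inner x f = 0) -> x = 0 by case: (FP p) => _ _; exact.
have [[p Finf]|Ffin] := pselect (exists p, infinite_set (F p)).
  have [_ _ _ atp] := MLP p.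
  exact: (infinite_atom_not_dense n (NM p) (NL p) (properW (LM p)) atp
    (FE p) (Fon p) (Ftot p) Finf).
have {}Ffin p : finite_set (F p) by apply: contrapT => Finf; apply: Ffin; exists p.
have E_lt p q x y : omega2 p q -> p <> q -> E p x -> E q y -> inner y x = 0.
  by move=> pq npq [Mx _] [_]; apply; apply: ML_lt pq npq _ Mx.
have E_ortho p q x y : p <> q -> E p x -> E q y -> inner x y = 0.
  move=> npq Ex Ey; have [pq|qp] : omega2 p q \/ omega2 q p by apply/orP/le_total.
    by apply: inner_eq0C; exact: E_lt Ex Ey.
  by apply: E_lt Ey Ex => //; exact: nesym.
have F1 p x : F p x -> inner x x = 1 by move=> Fx; rewrite (Fon p)// eqxx.
have F_disj p q x : F p x -> F q x -> p = q.
  move=> Fp Fq; apply: contrapT => npq; have := E_ortho _ _ x x npq (FE _ _ Fp) (FE _ _ Fq).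
  by rewrite (F1 _ _ Fp) => /eqP; rewrite oner_eq0.
have F_neq0 p : F p !=set0.
  apply: contrapT => F0; have [z Ez] := orthogonal_difference_neq0 (Mcs p) (Lcs p) (LM p).
  by apply; apply: Ftot Ez _ => f Ff; case: F0; exists f.
pose U i := \bigcup_k F (i, k).
(* The atoms [(i, k)], for [k : nat], have disjoint, finite, nonempty bases, so the union is
   denumerable. *)
have Ucard i : ([set: nat] #= U i)%card.
  rewrite card_eq_le; apply/andP; split; last first.
    by apply: bigcup_countable => // k _; exact: finite_set_countable.
  have [c cF] := choice (fun k => F_neq0 (i, k)).
  have cI : {in [set: nat] &, injective c}.
    move=> k l _ _ ckl; suff [] : (i, k) = (i, l) by [].
    by apply: (F_disj _ _ (c k)); [exact: cF|rewrite ckl; exact: cF].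
  rewrite -(card_le_eql (inj_card_eq cI)); apply: subset_card_le => _ [k _ <-].
  by exists k.
have phiP i : exists phi : nat -> H, injective phi /\ range phi = U i.
  have /pcard_eqP[phi] := Ucard i; exists phi; split; last exact: image_eq.
  by move=> k l kl; apply: (inj (f := phi)); rewrite ?inE.
have [phi phiPP] := choice phiP.
have phi_in i k : exists l, F (i, l) (phi i k).
  have [_ phiU] := phiPP i; have : U i (phi i k) by rewrite -phiU; exists k.
  by case=> l _ Fl; exists l.
pose f0 (p : nat * nat) := phi p.1 p.2.
have f0_on : orthonormal_family f0.
  move=> [i k] [j l]; rewrite /f0 /=; have [k' Fk] := phi_in i k; have [l' Fl] := phi_in j l.
  have [[ij kl]|nijkl] := pselect ((i, k') = (j, l')).
    rewrite -ij -kl in Fl *; rewrite (Fon (i, k'))// xpair_eqE eqxx /=.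
    by have [phiI _] := phiPP i; rewrite (inj_eq phiI).
  rewrite (E_ortho _ _ _ _ nijkl)//; [|exact: FE|exact: FE].
  case: eqP => // -[ij kl]; case: nijkl; apply: F_disj Fk _; rewrite ij kl; exact: Fl.
pose f := OnFamily f0_on.
(* The lower end of the first atom in the [i]-th group of omega atoms; it contains all earlier
   groups. *)
pose B i := L (i, 0%N).
have LB i k : L (i, 0%N) `<=` L (i, k).
  case: k => // k; apply: subset_trans (properW (LM (i, 0%N))) _; apply: ML_lt => //.
  by rewrite omega2E eqxx orbT.
have MB i k : M (i, k) `<=` B i.+1 by apply: ML_lt => //; [rewrite omega2E ltnSn|case; lia].
have Bf : block_basis N B f.
  split=> [i|i|i k|i k y By|x _ xf j y By]; first exact: NL.
  - exact: subset_trans (properW (LM (i, 0%N))) (MB i 0%N).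
  - by have [l Fl] := phi_in i k; have [Ml _] := FE _ _ Fl; exact: MB Ml.
  - by have [l Fl] := phi_in i k; have [_] := FE _ _ Fl; apply; exact: LB By.
  (* A vector not orthogonal to [B j] is not orthogonal to some atom below [B j]. That atom is
     listed, yet [x] is orthogonal to its basis. *)
  apply: contrapT => xy; have xB : ~ ortho x (B j) by move=> /(_ y By).
  have [K [K' [[NK NK' K'K KB Kat] [xK' xK]]]] := minimal_atom wo (NL (j, 0%N)) xB.
  have [[i k] Ep] := ML_init K K' (j, 0%N) NK NK' K'K KB Kat.
  apply: xK; apply: (ortho_split (nest_subspace NK) (nest_subspace NK') K'K xK').
  rewrite -Ep; apply: (total_ortho (Ecs (i, k)) (Ftot (i, k)) (FE (i, k))) => z Fz.
  have [_ phiU] := phiPP i; have : U i z by exists k.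
  by rewrite -phiU => -[l _ <-]; exact: (xf (i, l)).
by split; [exact: (left_blocks_not_dense Bf)|exact: (right_blocks_not_dense Bf)].
Qed.

End atom_dichotomy.

Theorem corollary5p6 (R : realType) (H : hilbertType R) (N : nest H)
    (A : Type) (r : rel A)
    (r_wo : well_order r)
    (N_type : has_ordinal_type N r)
    (omega2_le_r : ordinal_le omega2 r) :
  ltsr (nest_alg N) = +oo%E /\ rtsr (nest_alg N) = +oo%E.
Proof.
have nd n := unimodular_not_dense N_type omega2_le_r n.
by split; [apply: ltsr_infty|apply: rtsr_infty] => n _; have [] := nd n.
Qed.
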